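(* Let $X$ be a uniformly convex and uniformly smooth Banach space and let $T:X\to X$ be a compact linear map with trivial kernel and dense range. Let the eigenvalues of $T$, repeated according to algebraic multiplicity and arranged by decreasing modulus, be denoted by $\hat\lambda_n(T)$, and for each $k\in\mathbb{N}$ let $\lambda_n(T^k)$ be the $j$-eigenvalues of $T^k$. Then for each $n\in\mathbb{N}$, $$|\hat\lambda_n(T)|=\lim_{k\to\infty}\lambda_n(T^k)^{1/k}.$$
   Context: $X$ is a real, reflexive, infinite-dimensional Banach space. Eigenvalues of $T$ are those of its complexification; if there are fewer than $n$ nonzero eigenvalues (counted with algebraic multiplicity), $\hat\lambda_n(T)=0$. Duality maps. For a uniformly convex and uniformly smooth space $Z$ and $z\ne 0$, $\widetilde J_Z(z)$ is the unique element of $Z^*$ with $\|\widetilde J_Z(z)\|_{Z^*}=1$ and $\langle z,\widetilde J_Z(z)\rangle_Z=\|z\|_Z$; $J_Z(z)=\mu_Z(\|z\|_Z)\widetilde J_Z(z)$, $J_Z(0)=0$, where $\mu_Z$ is a fixed gauge function (continuous, strictly increasing on $[0,\infty)$, $\mu_Z(0)=0$, $\mu_Z(t)\to\infty$) with $\mu_Z(1)=1$. $j$-eigenvalues. For a compact linear map $S:X\to Y$ between uniformly convex and uniformly smooth spaces, put $X_1=X$ and choose $x_1\in X$ with $\|x_1\|_X=1$, $\|Sx_1\|_Y=\|S\|=:\lambda_1(S)$. Given $x_1,\dots,x_{k-1}$, put $X_k=\{x\in X:\langle x,J_Xx_i\rangle_X=0,\ i<k\}$; if $S|_{X_k}\neq0$,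 choose $x_k\in X_k$ with $\|x_k\|_X=1$ and $\|Sx_k\|_Y=\lambda_k(S):=\|S|_{X_k}\|$. The procedure does not stop when $\ker S=\{0\}$ and $\dim X=\infty$. The $x_k$ are called $j$-eigenvectors and the $\lambda_k(S)$ $j$-eigenvalues of $S$. *)

(* Defs.v *)
From HB Require Import structures.
From mathcomp Require Import all_boot all_order all_algebra.
From mathcomp Require Import all_classical all_reals all_analysis.
From mathcomp Require Import complex.
Set Implicit Arguments.
Unset Strict Implicit.
Unset Printing Implicit Defensive.
Import Order.TTheory GRing.Theory Num.Theory.
Import numFieldNormedType.Exports.
Local Open Scope classical_set_scope.
Local Open Scope ring_scope.

Section LinearAlgebra.
Context {K : fieldType} {V : lmodType K}.

Definition lin_indep n (v : 'I_n -> V) : Prop :=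
  forall c : 'I_n -> K, \sum_(i < n) c i *: v i = 0 -> forall i, c i = 0.

Definition lin_span n (v : 'I_n -> V) : set V :=
  [set w | exists c : 'I_n -> K, w = \sum_(i < n) c i *: v i].

Definition has_dim (E : set V) (n : nat) : Prop :=
  exists v : 'I_n -> V, lin_indep v /\ lin_span v = E.

End LinearAlgebra.

Definition infinite_dimensional (K : fieldType) (V : lmodType K) : Prop :=
  forall n, ~ has_dim [set: V] n.

Section Spaces.
Context {R : realType}.

Definition uniformly_convex (X : normedModType R) : Prop :=
  forall e : R, 0 < e <= 2 -> exists2 d : R, 0 < d &
    forall x y : X, `|x| = 1 -> `|y| = 1 -> e <= `|x - y| ->
      `|2^-1 *: (x + y)| <= 1 - d.

(* The modulus of smoothness rho satisfies rho(t) / t --> 0 as t --> 0+. *)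
Definition uniformly_smooth (X : normedModType R) : Prop :=
  forall e : R, 0 < e -> exists2 d : R, 0 < d &
    forall x y : X, `|x| = 1 -> `|y| <= d ->
      (`|x + y| + `|x - y|) / 2 - 1 <= e * `|y|.

(* The norm of the restriction of [S] to the subspace [D]; the supremum is a
   meaningful norm only when [S] is bounded on the unit ball of [D]. *)
Definition opnorm_on (X Y : normedModType R) (D : set X) (S : X -> Y) : R :=
  sup [set `|S x| | x in D `&` [set x | `|x| <= 1]].

Definition compact_map (X Y : normedModType R) (S : X -> Y) : Prop :=
  compact (closure (S @` [set x | `|x| <= 1])).

Definition dual (X : normedModType R) : set (X -> R^o) :=
  [set f | linear f /\ continuous f].

Definition dual_norm (X : normedModType R) (f : X -> R^o) : R :=
  opnorm_on [set: X] f.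

(* [phi] is only constrained on [dual X], where it is an element of the
   bidual. *)
Definition reflexive_space (X : normedModType R) : Prop :=
  forall phi : (X -> R^o) -> R,
    (forall (a : R) (f g : X -> R^o), dual f -> dual g ->
       phi (fun x => a * f x + g x) = a * phi f + phi g) ->
    (exists C : R, forall f : X -> R^o, dual f ->
       `|phi f| <= C * dual_norm f) ->
    exists x : X, forall f : X -> R^o, dual f -> phi f = f x.

Definition is_gauge (mu : R -> R) : Prop :=
  [/\ {within `[0, +oo[, continuous mu},
      {in `[0, +oo[ &, {homo mu : s t / s < t}},
      mu 0 = 0 & mu t @[t --> +oo] --> +oo].

Section Duality.
Context {X : normedModType R} (mu : R -> R).

Definition norming_set (z : X) : set (X -> R^o) :=
  [set f | [/\ dual f, dual_norm f = 1 & f z = `|z|]].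

(* When [X] is uniformly smooth, [norming_set z] is a singleton for [z != 0],
   so [get] is a definite description. *)
Definition Jtilde (z : X) : X -> R^o := get (norming_set z).

Definition J (z : X) : X -> R^o :=
  if z == 0 then fun=> 0 else fun x => mu `|z| * Jtilde z x.

End Duality.

(* Indices are shifted by one: the j-eigenvectors x_1, x_2, ... are x 0, x 1,
   ..., and [jspace mu x k], [jeigenvalue mu S x k] are X_(k+1),
   lambda_(k+1)(S). *)
Section JEigen.
Context {X Y : normedModType R} (mu : R -> R) (S : X -> Y) (x : nat -> X).

Definition jspace (k : nat) : set X :=
  [set y | forall i, (i < k)%N -> J mu (x i) y = 0].

Definition jeigenvalue (k : nat) : R := opnorm_on (jspace k) S.

(* The procedure stops at the first [k] where [S] vanishes on [jspace k]; from
   then on [x] is arbitrary, and [jeigenvalue] is 0. *)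
Definition jeigenvectors : Prop :=
  forall k, (exists2 y, jspace k y & S y != 0) ->
    [/\ jspace k (x k), `|x k| = 1 & `|S (x k)| = jeigenvalue k].

End JEigen.

End Spaces.

Definition complexification (R : rcfType) (V : lmodType R) : Type := (V * V)%type.

Section Complexification.
Context {R : rcfType} (V : lmodType R).
Local Notation VC := (complexification V).

HB.instance Definition _ := GRing.Zmodule.copy VC (V * V)%type.

(* (a + ib)(u + iv) = (au - bv) + i(av + bu), with (u, v) standing for u + iv. *)

Definition complex_scale (z : R[i]) (w : VC) : VC :=
  (complex.Re z *: w.1 - complex.Im z *: w.2,
   complex.Re z *: w.2 + complex.Im z *: w.1).

Fact complex_scaleA a b (w : VC) :
  complex_scale a (complex_scale b w) = complex_scale (a * b) w.
Proof.
case: a b w => [a a'] [b b'] [u v]; rewrite /complex_scale /=.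
congr pair; rewrite !scalerBr !scalerDr !scalerBl !scalerDl !scalerA.
  by rewrite !opprD [RHS]addrACA [- ((_ * _) *: u) - _]addrC.
by rewrite [RHS]addrACA [- ((_ * _) *: v) + _]addrC.
Qed.

Fact complex_scale1 : left_id 1 complex_scale.
Proof.
by move=> [u v]; rewrite /complex_scale /= !scale1r !scale0r subr0 addr0.
Qed.

Fact complex_scaleDr : right_distributive complex_scale +%R.
Proof.
move=> [a b] [u v] [u' v']; rewrite /complex_scale /=.
by congr pair; rewrite /= !scalerDr ?opprD addrACA.
Qed.

Fact complex_scaleDl (w : VC) : {morph complex_scale^~ w : a b / a + b}.
Proof.
move=> [a a'] [b b']; case: w => u v; rewrite /complex_scale /=.
by congr pair; rewrite /= !scalerDl ?opprD addrACA.
Qed.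

HB.instance Definition _ := GRing.Zmodule_isLmodule.Build R[i] VC
  complex_scaleA complex_scale1 complex_scaleDr complex_scaleDl.

Definition complexify (T : V -> V) (w : VC) : VC := (T w.1, T w.2).

(* The union over m of the kernels of (T_C - z)^m; its dimension over R[i] is
   the algebraic multiplicity of z (0 when z is not an eigenvalue). *)
Definition generalized_eigenspace (T : V -> V) (z : R[i]) : set VC :=
  [set w | exists m, iter m (fun u : VC => complexify T u - z *: u) w = 0].

(* [lam] lists the nonzero eigenvalues of T by decreasing modulus, each one as
   often as its algebraic multiplicity, and is padded with 0 if there are only
   finitely many of them. The norm of R[i] takes its values in R[i], hence the
   real parts. *)
Definition eigenvalue_sequence (T : V -> V) (lam : nat -> R[i]) : Prop :=
  (forall n, complex.Re `|lam n.+1| <= complex.Re `|lam n|) /\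
  (forall z : R[i], z != 0 -> forall m : nat,
     has_dim (generalized_eigenspace T z) m <->
     ([set n | lam n = z] #= `I_m)%card).

End Complexification.

(* Main.v *)
From HB Require Import structures.
Require Import Defs.
From mathcomp Require Import all_boot all_order all_algebra.
From mathcomp Require Import all_classical all_reals all_analysis.
From mathcomp Require Import complex cyclic separable cyclotomic.
From mathcomp Require Import lra ring.
Set Implicit Arguments.
Unset Strict Implicit.
Unset Printing Implicit Defensive.
Import Order.TTheory GRing.Theory Num.Theory.
Import numFieldNormedType.Exports.
Local Open Scope classical_set_scope.
Local Open Scope ring_scope.
Import Normc.

(** Fix [n] and put [r = |lamhat n|]. The proof squeezes the j-eigenvalue
    [jeigenvalue (T^k) n] between [c * rho ^ k] for every [rho < r] and
    [C * s ^ k] for every [s > r], where [c] and [C] do not depend on [k];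
    constants disappear under k-th roots ([root_limit]).

    Lower bound ([kernel_lower_bound]). The space [jspace n] is the common
    kernel of [n] functionals, and [T^k] is bounded on it by the j-eigenvalue.
    If [r > 0], the eigenvalues of modulus at least [r] provide [n + 1] independent
    generalized eigenvectors in the complexification, so some nonzero
    combination [w] of them has its real and imaginary parts in [jspace n].
    Whatever the combination, [w] is killed by one fixed product of operators
    [T - z] with [r <= |z|], and on such vectors [T^k] expands at least like
    [rho ^ k] ([spectral_lower_growth]).

    Upper bound ([kernel_upper_bound], [jeigenvalue_upper]). The generalized
    eigenvectors for the eigenvalues of modulus above [r] span a space of
    dimension at most [n]; let [P] be a bounded projection onto its real part.
    The operator [(1 - P) T] is compact and has no eigenvalue of modulus above
    [r], so its powers are [O(s ^ k)] ([compact_power_bound]); and [T^k u] equals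
    [((1 - P) T)^k u] as soon as [P (T^k u) = 0] and [k > 0]. The latter condition amounts to
    at most [n] linear equations, hence has a nontrivial solution among the
    combinations of the [n + 1] j-eigenvectors [x_0, ..., x_n] of [T^k]. The
    norm being smooth, the functional norming [T^k x_i] vanishes on [T^k x_j]
    for [i < j] ([norming_extremal]); this triangular system shows that [T^k] is
    bounded below, up to a factor depending only on [n], by its n-th j-eigenvalue
    on these combinations ([jeigen_triangular]).

    The spectral radius estimate [compact_power_bound] rests on a lower bound
    for [T - z] on an annulus, which compactness gives in the absence of
    eigenvalues, and on averages over roots of unity in the role of Cauchy
    integrals. Norming functionals are derivatives of the norm, linear because
    of uniform smoothness. *)

(** * Finite families in vector spaces *)

Section LinearAlgebra.
Context {K : fieldType} {V : lmodType K}.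

Lemma scalar_map0 (f : V -> K) :
  (forall a u w, f (a *: u + w) = a * f u + f w) -> f 0 = 0.
Proof.
by move=> fL; have := fL (-1) 0 0; rewrite scaler0 addr0 mulN1r addNr.
Qed.

Lemma scalar_map_sum (f : V -> K) n (c : 'I_n -> K) (v : 'I_n -> V) :
  (forall a u w, f (a *: u + w) = a * f u + f w) ->
  f (\sum_i c i *: v i) = \sum_i c i * f (v i).
Proof.
move=> fL; elim/big_rec2: _ => [|i y w _ <-]; first exact: scalar_map0.
exact: fL.
Qed.

Lemma exists_left_kernel m n (A : 'I_m -> 'I_n -> K) : (n < m)%N ->
  exists2 c : 'I_m -> K, (exists i, c i != 0) &
    forall j, \sum_i c i * A i j = 0.
Proof.
move=> nm; pose M := \matrix_(i, j) A i j.
have: kermx M != 0.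
  rewrite kermx_eq0 /row_free neq_ltn; apply/orP; left.
  exact: leq_ltn_trans (rank_leq_col _) nm.
move=> /rowV0Pn[v /sub_kermxP vM v0].
exists (fun i => v 0 i).
  have /rV0Pn[i vi] := v0; by exists i.
move=> j; have /matrixP/(_ 0 j) := vM; rewrite !mxE => E; rewrite -[RHS]E.
by apply: eq_bigr => i _; rewrite mxE.
Qed.

Definition spanned_by (E : set V) n := exists b : 'I_n -> V, E `<=` lin_span b.

Definition has_indep (E : set V) n :=
  exists2 v : 'I_n -> V, lin_indep v & forall i, E (v i).

Lemma linear_set_sum (E : set V) n (c : 'I_n -> K) (v : 'I_n -> V) :
  E 0 -> (forall a u w, E u -> E w -> E (a *: u + w)) ->
  (forall i, E (v i)) -> E (\sum_i c i *: v i).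
Proof.
move=> E0 EL Ev; elim/big_rec: _ => // i w _ Ew; exact: EL.
Qed.

Lemma lin_indep_extend n (v : 'I_n -> V) (w : V) :
  lin_indep v -> ~ lin_span v w ->
  lin_indep (fun i : 'I_n.+1 => if unlift ord_max i is Some j then v j else w).
Proof.
move=> vI wv c; rewrite big_ord_recr /= unlift_none.
have wl (i : 'I_n) : widen_ord (leqnSn n) i = lift ord_max i.
  by apply: val_inj; exact/esym/lift_max.
under eq_bigr => i _ do rewrite wl liftK.
move=> cE.
have c0 : c ord_max = 0.
  apply/eqP/negPn/negP => cN0; apply: wv.
  exists (fun i => - (c ord_max)^-1 * c (lift ord_max i)).
  under eq_bigr => i _ do rewrite -scalerA.
  rewrite -scaler_sumr.
  have /eqP := cE; rewrite addrC addr_eq0 => /eqP/(congr1 ( *:%R (c ord_max)^-1)).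
  by rewrite scalerA mulVf // scale1r scalerN scaleNr => ->.
move: cE; rewrite c0 scale0r addr0 => /vI ci i.
by case: (unliftP ord_max i) => [j ->|->].
Qed.

(** A maximal independent family is a basis, so greedy extension can only stop
    at a basis. *)
Lemma indep_or_has_dim (E : set V) (n : nat) :
  E 0 -> (forall a u w, E u -> E w -> E (a *: u + w)) ->
  has_indep E n \/ (exists2 m, (m < n)%N & has_dim E m).
Proof.
move=> E0 EL; elim: n => [|n [[v vI Ev]|[m mn Em]]].
- by left; exists (fun=> 0) => [c _ []|[]].
- have [vE|/existsNP[w]] := pselect (forall w, E w -> lin_span v w).
    right; exists n => //; exists v; split=> //.
    apply/seteqP; split => // _ [c ->]; exact: linear_set_sum.
  move=> /not_implyP[Ew vw]; left.
  eexists; first exact: (lin_indep_extend vI vw).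
  by move=> i /=; case: (unlift ord_max i) => [j|]; [exact: Ev|exact: Ew].
- by right; exists m => //; exact: ltnW.
Qed.

Lemma common_kernel_vector n (f : 'I_n -> V -> K) (v : 'I_n.+1 -> V) :
  (forall j a u w, f j (a *: u + w) = a * f j u + f j w) ->
  lin_indep v ->
  exists c : 'I_n.+1 -> K, \sum_i c i *: v i != 0 /\
    forall j, f j (\sum_i c i *: v i) = 0.
Proof.
move=> fL vI; have [c [i ci] cf] := exists_left_kernel (fun i j => f j (v i)) (ltnSn n).
exists c; split.
  by apply: contra ci => /eqP /vI ->.
by move=> j; rewrite scalar_map_sum.
Qed.

Lemma span_bounds_indep n m (b : 'I_n -> V) (v : 'I_m -> V) :
  (forall i, lin_span b (v i)) -> lin_indep v -> (m <= n)%N.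
Proof.
move=> bv vI; rewrite leqNgt; apply/negP => nm.
have /choice[a av] := bv.
have [c [i ci] ca] := exists_left_kernel a nm.
suff /vI/(_ i) ci0 : \sum_k c k *: v k = 0 by rewrite ci0 eqxx in ci.
under eq_bigr => j _ do rewrite av scaler_sumr.
rewrite exchange_big big1 // => l _ /=.
under eq_bigr => j _ do rewrite scalerA.
by rewrite -scaler_suml ca scale0r.
Qed.

Lemma spanned_by_add (E F : set V) m n :
  spanned_by E m -> spanned_by F n ->
  spanned_by [set u + v | u in E & v in F] (m + n).
Proof.
move=> [b Eb] [d Fd].
exists (fun i : 'I_(m + n) =>
  match fintype.split i with inl j => b j | inr k => d k end).
move=> _ [u /Eb[cu ->] [v /Fd[cv ->] <-]].
exists (fun i : 'I_(m + n) =>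
  match fintype.split i with inl j => cu j | inr k => cv k end).
rewrite big_split_ord /=; congr (_ + _); apply: eq_bigr => i _.
  by rewrite (unsplitK (inl i)).
by rewrite (unsplitK (inr i)).
Qed.

End LinearAlgebra.

(** * Kernels of products of operators [T - z] *)

Section Spectral.
Context {K : fieldType} {V : lmodType K} (T : {linear V -> V}).

Definition shift (z : K) (u : V) : V := T u - z *: u.

Fact shift_is_linear z : linear (shift z).
Proof.
move=> a u w; rewrite /shift linearP scalerDr scalerBr opprD addrACA.
by congr (_ - _ + _); rewrite !scalerA mulrC.
Qed.

HB.instance Definition _ z :=
  GRing.isLinear.Build K V V *:%R (shift z) (shift_is_linear z).

Lemma shift_comm y z u : shift y (shift z u) = shift z (shift y u).
Proof.
rewrite /shift !linearB !linearZ /= addrACA; congr (_ + (_ + _)).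
by rewrite !scalerA mulrC.
Qed.

Lemma shift_T z u : shift z (T u) = T (shift z u).
Proof. by rewrite /shift linearB [T (z *: u)]linearZ. Qed.

Lemma shift_iterT z k u : shift z (iter k T u) = iter k T (shift z u).
Proof. by elim: k => //= k <-; rewrite shift_T. Qed.

Definition shifts (s : seq K) (u : V) : V := foldr shift u s.

Lemma shifts_is_linear s : linear (shifts s).
Proof. by elim: s => [|z s IH] a u w //=; rewrite IH linearP. Qed.

HB.instance Definition _ s :=
  GRing.isLinear.Build K V V *:%R (shifts s) (shifts_is_linear s).

Lemma shifts_cat s1 s2 u : shifts (s1 ++ s2) u = shifts s1 (shifts s2 u).
Proof. exact: foldr_cat. Qed.

Lemma shifts_shift s z u : shifts s (shift z u) = shift z (shifts s u).
Proof. by elim: s => //= y s ->; rewrite shift_comm. Qed.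

Lemma shifts_comm s1 s2 u : shifts s1 (shifts s2 u) = shifts s2 (shifts s1 u).
Proof. by elim: s1 => //= z s ->; rewrite shifts_shift. Qed.

(** The sum of the generalized eigenspaces of the eigenvalues in [Z]. Products of
    operators [T - z] take the place of a polynomial functional calculus: they
    commute, and concatenating two lists of roots shows that the sum of two
    vectors killed by such products is killed by a third one. *)
Definition spectral (Z : pred K) : set V :=
  [set u | exists2 s, all Z s & shifts s u = 0].

Lemma spectral0 Z : spectral Z 0.
Proof. by exists [::]. Qed.

Lemma spectralP Z a u w :
  spectral Z u -> spectral Z w -> spectral Z (a *: u + w).
Proof.
move=> [s Zs su] [t Zt tw]; exists (s ++ t); first by rewrite all_cat Zs.
by rewrite linearP /= !shifts_cat tw shifts_comm su !linear0 addr0.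
Qed.

Lemma spectralD Z u w : spectral Z u -> spectral Z w -> spectral Z (u + w).
Proof. by move=> Zu Zw; rewrite -[u]scale1r; exact: spectralP. Qed.

Lemma spectralZ Z a u : spectral Z u -> spectral Z (a *: u).
Proof.
by move=> Zu; rewrite -[_ *: _]addr0; apply: spectralP => //; exact: spectral0.
Qed.

Lemma spectralB Z u w : spectral Z u -> spectral Z w -> spectral Z (u - w).
Proof. by move=> Zu Zw; rewrite addrC -scaleN1r; exact: spectralP. Qed.

Lemma sub_spectral (Z1 Z2 : pred K) u :
  {subset Z1 <= Z2} -> spectral Z1 u -> spectral Z2 u.
Proof. by move=> Z12 [s Zs su]; exists s => //; apply: sub_all Zs. Qed.

Lemma spectral_T Z u : spectral Z u -> spectral Z (T u).
Proof.
move=> [s Zs su]; exists s => //.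
have -> : shifts s (T u) = T (shifts s u).
  by elim: s {Zs su} => //= z s ->; rewrite shift_T.
by rewrite su linear0.
Qed.

Lemma spectral_shift_inv (Z : pred K) z u :
  Z z -> spectral Z (shift z u) -> spectral Z u.
Proof.
by move=> Zz [s Zs su]; exists (z :: s); rewrite /= ?Zz // -shifts_shift.
Qed.

(** On the kernel of [T - y] each factor [T - z] acts as the scalar [y - z], which
    is nonzero when [z] is in [Z] and [y] is not. *)
Lemma shift_inj_spectral (Z : pred K) y u :
  ~~ Z y -> spectral Z u -> shift y u = 0 -> u = 0.
Proof.
move=> Zy [s Zs su] /eqP; rewrite subr_eq0 => /eqP yu.
have shE z : shift z u = (y - z) *: u by rewrite /shift yu scalerBl.
move: su Zs; elim: s => //= z s IH.
rewrite -shifts_shift shE linearZ /= => /eqP; rewrite scaler_eq0 subr_eq0.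
case/orP => [/eqP yz|/eqP su] /andP[Zz Zs]; last exact: IH.
by move: Zz; rewrite -yz (negPf Zy).
Qed.

Lemma spectral_shift Z y u : spectral Z u -> spectral Z (shift y u).
Proof. by move=> Zu; apply: spectralB; [exact: spectral_T|exact: spectralZ]. Qed.

(** Since [(y - z) u = (T - z) u - (T - y) u] and [(T - z) u] is killed by a shorter
    product, an antecedent of [u] is obtained from one of [(T - z) u]. *)
Lemma shift_surj_spectral (Z : pred K) y u :
  ~~ Z y -> spectral Z u -> exists2 v, spectral Z v & shift y v = u.
Proof.
move=> Zy [s]; elim: s u => [|z s IH] u /=.
  by move=> _ ->; exists 0; [exact: spectral0|rewrite linear0].
move=> /andP[Zz Zs]; rewrite -shifts_shift => su.
have [v Zv vE] := IH _ Zs su.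
have yz : y - z != 0 by apply: contra Zy; rewrite subr_eq0 => /eqP ->.
have Zu : spectral Z u by exists (z :: s); rewrite /= ?Zz // -shifts_shift.
exists ((y - z)^-1 *: (v - u)).
  by apply: spectralZ; exact: spectralB.
have -> : shift y ((y - z)^-1 *: (v - u)) = (y - z)^-1 *: (shift y v - shift y u).
  by rewrite [LHS]linearZ /= [shift y (v - u)]linearB.
have -> : shift y v - shift y u = (y - z) *: u.
  by rewrite vE /shift opprB addrC addrA subrK scalerBl.
by rewrite scalerA mulVf // scale1r.
Qed.

Lemma spectral_disjoint (Z1 Z2 : pred K) u :
  (forall z, Z1 z -> ~~ Z2 z) -> spectral Z1 u -> spectral Z2 u -> u = 0.
Proof.
move=> Z12 [s]; elim: s u => // z s IH u /= /andP[Zz Zs] su Z2u.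
apply: (shift_inj_spectral (Z12 _ Zz)) => //.
by apply: IH => //; [rewrite shifts_shift|exact: spectral_shift].
Qed.

(** If [(T - z) u] is already split and [z] is in [Z1], then [T - z] is onto on the
    [Z2] part: an antecedent of the [Z2] component is the [Z2] component of [u],
    and symmetrically. *)
Lemma spectral_split (Z1 Z2 : pred K) u :
  (forall z, Z1 z -> ~~ Z2 z) -> spectral (predU Z1 Z2) u ->
  exists u1 u2, [/\ spectral Z1 u1, spectral Z2 u2 & u = u1 + u2].
Proof.
move=> Z12 [s]; elim: s u => [|z s IH] u /=.
  by move=> _ ->; exists 0, 0; rewrite addr0; split=> //; exact: spectral0.
move=> /andP[Zz Zs]; rewrite -shifts_shift => su.
have [w1 [w2 [Zw1 Zw2 wE]]] := IH _ Zs su.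
case/orP: Zz => Zz.
  have [v2 Zv2 v2E] := shift_surj_spectral (Z12 _ Zz) Zw2.
  exists (u - v2), v2; split; rewrite ?subrK //.
  by apply: (spectral_shift_inv Zz); rewrite linearB /= v2E wE addrK.
have Zz1 : ~~ Z1 z by apply/negP => /Z12; rewrite Zz.
have [v1 Zv1 v1E] := shift_surj_spectral Zz1 Zw1.
exists v1, (u - v1); split; rewrite ?[v1 + _]addrC ?subrK //.
by apply: (spectral_shift_inv Zz); rewrite linearB /= v1E wE addrC addKr.
Qed.

Lemma spectral_pred1 z u :
  spectral (pred1 z) u <-> exists m, iter m (shift z) u = 0.
Proof.
have iterE m : iter m (shift z) u = shifts (nseq m z) u by elim: m => //= m ->.
split=> [[s /all_pred1P sE su]|[m mu]].
  by exists (size s); rewrite iterE -sE.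
by exists (nseq m z); [apply/all_pred1P; rewrite size_nseq|rewrite -iterE].
Qed.

(** A factor [T - z] that is injective on the whole space can be cancelled. *)
Lemma spectral_filter (Z L : pred K) u :
  (forall z v, Z z -> ~~ L z -> shift z v = 0 -> v = 0) ->
  spectral Z u -> spectral L u.
Proof.
move=> ZL [s]; elim: s u => [|z s IH] u /=; first by move=> _ ->; exact: spectral0.
move=> /andP[Zz Zs]; rewrite -shifts_shift => su.
have Lu := IH _ Zs su; have [Lz|Lz] := boolP (L z).
  exact: spectral_shift_inv Lu.
have [v Lv vE] := shift_surj_spectral Lz Lu.
suff <- : v = u by [].
by apply/subr0_eq/(ZL z) => //; rewrite linearB /= vE subrr.
Qed.

Lemma has_indep_add (Z1 Z2 : pred K) m n :
  (forall z, Z1 z -> ~~ Z2 z) ->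
  has_indep (spectral Z1) m -> has_indep (spectral Z2) n ->
  has_indep (spectral (predU Z1 Z2)) (m + n).
Proof.
move=> Z12 [v vI Zv] [w wI Zw].
exists (fun i : 'I_(m + n) =>
  match fintype.split i with inl j => v j | inr k => w k end); last first.
  move=> i; case: (fintype.split i) => j.
    by apply: (sub_spectral _ (Zv j)) => z /= ; rewrite !unfold_in /= => ->.
  by apply: (sub_spectral _ (Zw j)) => z /= ; rewrite !unfold_in /= => ->; rewrite orbT.
move=> c; rewrite big_split_ord /=.
under eq_bigr => i _ do rewrite (unsplitK (inl i)).
under [X in _ + X]eq_bigr => i _ do rewrite (unsplitK (inr i)).
move=> /eqP; rewrite addr_eq0 => /eqP vw.
have v0 : \sum_i c (lshift n i) *: v i = 0.
  apply: (spectral_disjoint Z12).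
    by apply: linear_set_sum => //; [exact: spectral0|exact: spectralP].
  rewrite vw -scaleN1r; apply: spectralZ.
  by apply: linear_set_sum => //; [exact: spectral0|exact: spectralP].
move: vw; rewrite v0 => /esym/eqP; rewrite oppr_eq0 => /eqP w0.
move=> i; rewrite -(splitK i); case: (fintype.split i) => j /=.
  exact: (vI (fun j => c (lshift n j))).
exact: (wI (fun j => c (rshift m j))).
Qed.

Lemma spectral_spanned (s : seq K) (m : K -> nat) : uniq s ->
  {in s, forall z, spanned_by (spectral (pred1 z)) (m z)} ->
  spanned_by (spectral (mem s)) (\sum_(z <- s) m z).
Proof.
elim: s => [_ _|z s IH /= /andP[zs us] sp].
  rewrite big_nil; exists (fun=> 0) => u [[|y t]] //= _ ->.
  by exists (fun=> 0); rewrite big_ord0.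
rewrite big_cons.
have [b bE] := spanned_by_add (sp z (mem_head _ _))
  (IH us (fun y ys => sp y (@mem_behead _ (z :: s) y ys))).
exists b => u Zu; apply: bE.
have [||u1 [u2 [Z1 Z2 ->]]] := @spectral_split (pred1 z) (mem s) u.
- by move=> y /= /eqP ->.
- by apply: sub_spectral Zu => y; rewrite !inE.
by exists u1 => //; exists u2.
Qed.

Lemma spectral_has_indep (s : seq K) (m : K -> nat) : uniq s ->
  {in s, forall z, has_indep (spectral (pred1 z)) (m z)} ->
  has_indep (spectral (mem s)) (\sum_(z <- s) m z).
Proof.
elim: s => [_ _|z s IH /= /andP[zs us] sp].
  by rewrite big_nil; exists (fun=> 0) => [c _ []|[]].
rewrite big_cons.
have [|v vI Zv] := has_indep_add _ (sp z (mem_head _ _))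
  (IH us (fun y ys => sp y (@mem_behead _ (z :: s) y ys))).
  by move=> y /= /eqP ->.
exists v => // i; apply: sub_spectral (Zv i) => y; rewrite !inE.
Qed.

End Spectral.


(** * The complexified space and roots of unity *)

Section Complexified.
Context {R : realType} {X : normedModType R}.
Local Notation VC := (complexification X).

(** This norm is only equivalent to a complex norm: multiplication by a scalar of
    modulus 1 may double it. All estimates below are meant up to constants. *)
Definition cnorm (w : VC) : R := `|w.1| + `|w.2|.

Lemma cnorm_ge0 w : 0 <= cnorm w.
Proof. exact: addr_ge0. Qed.

Lemma cnorm0 : cnorm 0 = 0.
Proof. by rewrite /cnorm !normr0 addr0. Qed.

Lemma cnorm_eq0 w : cnorm w = 0 -> w = 0.
Proof.
case: w => u v /eqP; rewrite /cnorm paddr_eq0 //= !normr_eq0.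
by move=> /andP[/eqP -> /eqP ->].
Qed.

Lemma cnormD u w : cnorm (u + w) <= cnorm u + cnorm w.
Proof. by rewrite /cnorm addrACA lerD //=; exact: ler_normD. Qed.

Lemma cnormN w : cnorm (- w) = cnorm w.
Proof. by rewrite /cnorm /= !normrN. Qed.

Lemma cnormB u w : cnorm (u - w) <= cnorm u + cnorm w.
Proof. by rewrite -(cnormN w); exact: cnormD. Qed.

Lemma cnorm_sum I (r : seq I) (P : pred I) (F : I -> VC) :
  cnorm (\sum_(i <- r | P i) F i) <= \sum_(i <- r | P i) cnorm (F i).
Proof.
elim/big_rec2: _ => [|i y z _ le]; first by rewrite cnorm0.
by rewrite (le_trans (cnormD _ _)) // lerD2l.
Qed.

Lemma normc_ge0 (z : R[i]) : 0 <= normc z.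
Proof. by case: z => a b; exact: sqrtr_ge0. Qed.

Lemma ge_Re_normc (z : R[i]) : `|complex.Re z| <= normc z.
Proof.
by case: z => a b /=; rewrite -sqrtr_sqr ler_wsqrtr // lerDl sqr_ge0.
Qed.

Lemma ge_Im_normc (z : R[i]) : `|complex.Im z| <= normc z.
Proof.
by case: z => a b /=; rewrite -sqrtr_sqr ler_wsqrtr // lerDr sqr_ge0.
Qed.

Lemma cnormZ_le (z : R[i]) (w : VC) : cnorm (z *: w) <= 2 * normc z * cnorm w.
Proof.
have := ge_Re_normc z; have := ge_Im_normc z; set r := normc z => Imr Rer.
have Rn (x : X) : `|complex.Re z *: x| <= r * `|x| by rewrite normrZ ler_wpM2r.
have In (x : X) : `|complex.Im z *: x| <= r * `|x| by rewrite normrZ ler_wpM2r.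
rewrite /cnorm /= -mulrA mulr_natl mulr2n mulrDr lerD //.
  by rewrite (le_trans (ler_normB _ _)) // lerD.
by rewrite addrC (le_trans (ler_normD _ _)) // lerD.
Qed.

Lemma cnormZ_real (a : R) (w : VC) : cnorm (a%:C%C *: w) = `|a| * cnorm w.
Proof. by rewrite /cnorm /= !scale0r subr0 addr0 !normrZ mulrDr. Qed.

Lemma cnormZ_ge (z : R[i]) (w : VC) : normc z * cnorm w <= 2 * cnorm (z *: w).
Proof.
have [->|z0] := eqVneq z 0.
  by rewrite normc0 mul0r scale0r cnorm0 mulr0.
have nz : 0 < normc z.
  by rewrite lt_def normc_ge0 andbT; apply: contra z0 => /eqP/eq0_normc ->.
rewrite -[w in leLHS](@scale1r R[i]) -(mulVf z0) -scalerA.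
rewrite mulrC -ler_pdivlMr // (le_trans (cnormZ_le _ _)) //.
by rewrite normcV mulrAC.
Qed.

End Complexified.

Section RootsOfUnity.
Context {R : realType}.

(** Over an algebraically closed field of characteristic 0, [X^n - 1] has [n]
    distinct roots, and they form a cyclic group. *)
Lemma prim_root_exists n : (0 < n)%N -> exists z : R[i], n.-primitive_root z.
Proof.
pose p : {poly R[i]} := 'X^n - 1; have [r Dp] := closed_field_poly_normal p.
move=> n_gt0; rewrite (monicP _) ?monicXnsubC // scale1r in Dp.
have rn1 : all n.-unity_root r by apply/allP => z; rewrite -root_prod_XsubC -Dp.
have sz_r : (n < (size r).+1)%N.
  by rewrite -(size_prod_XsubC r id) -Dp size_XnsubC.
have [|z _ zP] := hasP (has_prim_root n_gt0 rn1 _ sz_r); last by exists z.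
by rewrite -separable_prod_XsubC -Dp separable_Xn_sub_1 // pnatr_eq0 -lt0n.
Qed.

Lemma normcX (z : R[i]) n : normc (z ^+ n) = normc z ^+ n.
Proof. by elim: n => [|n IH]; rewrite ?expr0 ?normc1 // !exprS normcM IH. Qed.

Lemma normc_unity_root (z : R[i]) n : (0 < n)%N -> z ^+ n = 1 -> normc z = 1.
Proof.
move=> n0 zn; have /eqP := congr1 (@normc R) zn.
by rewrite normcX normc1 pexprn_eq1 ?normc_ge0 // eqn0Ngt n0 => /eqP.
Qed.

Lemma sum_unity_root (z : R[i]) n : z ^+ n = 1 -> z != 1 ->
  \sum_(i < n) z ^+ i = 0.
Proof.
move=> zn z1; apply/eqP; have /eqP := subrX1 z n.
by rewrite zn subrr eq_sym mulf_eq0 subr_eq0 (negPf z1).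
Qed.

Context {X : normedModType R}.
Local Notation VC := (complexification X).

(** Discrete Cauchy estimate: the mean of [z ^- m] times the vector polynomial
    [\sum_i z ^+ i *: v i] over the n-th roots of unity is the coefficient [v m]. *)
Lemma unity_root_coef n (v : 'I_n -> VC) (B : R) :
  (forall z : R[i], z ^+ n = 1 -> cnorm (\sum_(i < n) z ^+ i *: v i) <= B) ->
  forall m, cnorm (v m) <= 2 * B.
Proof.
move=> vB m; have n0 : (0 < n)%N by apply: leq_trans (ltn_ord m).
have [w wP] := prim_root_exists n0.
have wl (l : nat) : (w ^+ l) ^+ n = 1 by rewrite exprAC (prim_expr_order wP) expr1n.
have coef : n%:R *: v m =
    \sum_(l < n) (w ^+ l) ^+ (n - m) *: \sum_(i < n) (w ^+ l) ^+ i *: v i.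
  under eq_bigr => l _ do rewrite scaler_sumr.
  rewrite exchange_big (bigD1 m) //= [X in _ + X]big1 ?addr0 => [|i im].
    under eq_bigr => l _ do
      rewrite scalerA -exprD subnK 1?ltnW ?ltn_ord // wl scale1r.
    by rewrite sumr_const card_ord scaler_nat.
  under eq_bigr => l _ do rewrite scalerA -exprD exprAC.
  rewrite -scaler_suml sum_unity_root ?scale0r ?wl //.
  (* n - m + i lies strictly between 0 and 2n, so n divides it only for i = m *)
  rewrite -(prim_order_dvd wP); apply/negP => dv.
  move/eqP: im; apply; apply: val_inj => /=.
  have mn := ltn_ord m; have i_n := ltn_ord i.
  move: dv; have [im|mi] := leqP i m.
    move=> /dvdn_leq; have : (n - m + i = n - (m - i))%N.
      by rewrite subnBA // addnBAC // ltnW.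
    move=> -> /(_ _) lenm; apply/eqP; rewrite eqn_leq im /=.
    rewrite leqNgt; apply/negP => im'.
    have := lenm; rewrite subn_gt0 (leq_ltn_trans (leq_subr _ _) mn) => /(_ isT).
    by rewrite leqNgt ltn_subrL n0 subn_gt0 im'.
  have -> : (n - m + i = n + (i - m))%N.
    by rewrite addnBAC 1?ltnW // addnBA // ltnW.
  rewrite dvdn_addr // => /dvdn_leq; rewrite subn_gt0 mi => /(_ isT).
  by rewrite leqNgt (leq_ltn_trans (leq_subr _ _) i_n).
have : cnorm (n%:R *: v m) <= n%:R * (2 * B).
  rewrite coef (le_trans (cnorm_sum _ _ _)) //.
  rewrite (@le_trans _ _ (\sum_(l < n) (2 * B))) //; last first.
    by rewrite sumr_const card_ord [leRHS]mulr_natl.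
  apply: ler_sum => l _; rewrite (le_trans (cnormZ_le _ _)) //.
  rewrite normcX (normc_unity_root n0 (wl l)) expr1n mulr1 ler_pM2l //.
  exact/vB/wl.
have -> : (n%:R : R[i]) = (n%:R : R)%:C%C by rewrite rmorph_nat.
by rewrite cnormZ_real normr_nat ler_pM2l // ltr0n.
Qed.

End RootsOfUnity.

(** * Decay of powers under a uniform resolvent bound *)

Section ResolventBounds.
Context {R : realType} {X : normedModType R}.
Local Notation VC := (complexification X).
Context (W : {linear VC -> VC}) (c : R) (c0 : 0 < c).
Hypothesis W_below : forall (z : R[i]) (u : VC), normc z = 1 ->
  c * cnorm u <= cnorm (u - z *: W u).

Definition geom_sum n (z : R[i]) (u : VC) : VC :=
  \sum_(i < n) z ^+ i *: iter i W u.

Lemma iter_linear_sum k n (a : 'I_n -> R[i]) (v : 'I_n -> VC) :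
  iter k W (\sum_i a i *: v i) = \sum_i a i *: iter k W (v i).
Proof.
elim: k => //= k ->; rewrite linear_sum; apply: eq_bigr => i _.
by rewrite linearZ.
Qed.

Lemma geom_sumE n z u :
  geom_sum n z u - z *: W (geom_sum n z u) = u - z ^+ n *: iter n W u.
Proof.
elim: n => [|n IH].
  by rewrite /geom_sum big_ord0 linear0 scaler0 expr0 scale1r !subrr.
rewrite /geom_sum big_ord_recr /= -/(geom_sum n z u) linearD scalerDr.
rewrite opprD addrACA IH [W (_ *: _)]linearZ /= scalerA -exprS.
by rewrite addrA subrK.
Qed.

Lemma geom_sum_le n z u : normc z = 1 ->
  c * cnorm (geom_sum n z u) <= cnorm (u - z ^+ n *: iter n W u).
Proof. by move=> z1; rewrite -geom_sumE; exact: W_below. Qed.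

(** At the n-th roots of unity [z], [1 - z W] maps the geometric sum to [u - W^n u]:
    the two ends of an orbit control everything in between. *)
Lemma iter_le_ends n (m : 'I_n) u :
  c * cnorm (iter m W u) <= 2 * (cnorm u + cnorm (iter n W u)).
Proof.
rewrite mulrC -ler_pdivlMr // -mulrA.
have n0 : (0 < n)%N by apply: leq_trans (ltn_ord m).
apply: (unity_root_coef (v := fun i : 'I_n => iter i W u)) => z zn.
rewrite -[X in cnorm X <= _]/(geom_sum n z u) ler_pdivlMr // mulrC.
rewrite (le_trans (geom_sum_le _ _ (normc_unity_root n0 zn))) //.
by rewrite zn scale1r cnormB.
Qed.

Lemma geom_sum_le_bounded C n z u : normc z = 1 ->
  (forall k v, cnorm (iter k W v) <= C * cnorm v) ->
  cnorm (geom_sum n z u) <= (1 + 2 * C) / c * cnorm u.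
Proof.
move=> z1 WC; rewrite mulrAC ler_pdivlMr // mulrC.
rewrite (le_trans (geom_sum_le _ _ z1)) // (le_trans (cnormB _ _)) //.
rewrite mulrDl mul1r lerD2l (le_trans (cnormZ_le _ _)) //.
by rewrite normcX z1 expr1n mulr1 -mulrA ler_pM2l.
Qed.

(** The square of a geometric sum has triangular weights, the largest being that
    of index [n - 1]. *)
Lemma geom_sum_sum n z u : geom_sum n z (geom_sum n z u) =
  \sum_(k < n.*2) z ^+ k *:
    ((\sum_(i < n) \sum_(j < n) ((i + j)%N == k :> nat))%:R *: iter k W u).
Proof.
transitivity (\sum_(i < n) \sum_(j < n) z ^+ (i + j) *: iter (i + j) W u).
  apply: eq_bigr => i _; rewrite iter_linear_sum scaler_sumr.
  by apply: eq_bigr => j _; rewrite scalerA -exprD iterD.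
have expand (k : 'I_n.*2) : z ^+ k *:
    ((\sum_(i < n) \sum_(j < n) ((i + j)%N == k :> nat))%:R *: iter k W u) =
  \sum_(i < n) \sum_(j < n)
    (z ^+ k * ((i + j)%N == k :> nat)%:R) *: iter k W u.
  rewrite scalerA natr_sum mulr_sumr scaler_suml; apply: eq_bigr => i _.
  by rewrite natr_sum mulr_sumr scaler_suml.
under [RHS]eq_bigr => k _ do rewrite expand.
rewrite [RHS]exchange_big; apply: eq_bigr => i _ /=.
rewrite [RHS]exchange_big; apply: eq_bigr => j _ /=.
have ij : (i + j < n.*2)%N by rewrite -addnn -addSn leq_add // ltnW.
rewrite (bigD1 (Ordinal ij)) //= eqxx mulr1 big1 ?addr0 // => k.
rewrite -val_eqE /= eq_sym => /negPf ->; by rewrite mulr0 scale0r.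
Qed.

Lemma count_antidiagonal n :
  (\sum_(i < n.+1) \sum_(j < n.+1) ((i + j)%N == n :> nat) = n.+1)%N.
Proof.
rewrite -[RHS]card_ord -sum1_card; apply: eq_bigr => i _.
have le_in : (i <= n)%N by rewrite -ltnS.
rewrite (bigD1 (rev_ord i)) //= subSS subnKC // eqxx big1 ?addn0 // => j.
rewrite -val_eqE /= subSS; apply: contraNeq; rewrite eqb0 negbK => /eqP ijn.
by rewrite -[X in (X - _)%N]ijn addKn.
Qed.

(** Two applications of the resolvent bound control the square of the geometric
    sum independently of [n], whereas its coefficient of index [n] carries the
    weight [n + 1] ([count_antidiagonal]). *)
Lemma iter_decay C n u : 0 <= C ->
  (forall k v, cnorm (iter k W v) <= C * cnorm v) ->
  n.+1%:R * cnorm (iter n W u) <= 2 * ((1 + 2 * C) / c) ^+ 2 * cnorm u.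
Proof.
move=> C0 WC; set K := _ / c.
have nn : (n < n.+1.*2)%N by rewrite -addnn addSn ltnS leq_addr.
pose v (k : 'I_n.+1.*2) : VC :=
  (\sum_(i < n.+1) \sum_(j < n.+1) ((i + j)%N == k :> nat))%:R *: iter k W u.
have := @unity_root_coef R X _ v (K ^+ 2 * cnorm u) _ (Ordinal nn).
rewrite {2}/v /= count_antidiagonal.
have -> : (n.+1%:R : R[i]) = (n.+1%:R : R)%:C%C by rewrite rmorph_nat.
rewrite cnormZ_real normr_nat mulrA; apply => z zn.
rewrite -geom_sum_sum; have z1 := normc_unity_root (isT : 0 < n.+1.*2)%N zn.
rewrite (le_trans (geom_sum_le_bounded _ _ z1 WC)) // -/K expr2 -mulrA.
rewrite ler_wpM2l //; last exact: geom_sum_le_bounded.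
by rewrite divr_ge0 ?addr_ge0 ?mulr_ge0 // ltW.
Qed.

(** By [iter_decay] the far end [W^n u] of the orbit tends to 0, and [iter_le_ends]
    then bounds the orbit by its near end: any power bound improves to one that
    depends on [c] alone. *)
Lemma power_bounded_uniform C : 0 <= C ->
  (forall k v, cnorm (iter k W v) <= C * cnorm v) ->
  forall k v, cnorm (iter k W v) <= 2 / c * cnorm v.
Proof.
move=> C0 WC k v; rewrite mulrAC ler_pdivlMr // [leLHS]mulrC.
set D := 2 * ((1 + 2 * C) / c) ^+ 2 * cnorm v.
apply/ler_addgt0Pr => e e0.
pose n := maxn k (Num.truncn (2 * D / e)).
have nn : 2 * D / e <= n.+1%:R.
  apply/ltW/(lt_le_trans (truncnS_gt _)).
  by rewrite ler_nat ltnS leq_maxr.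
have kn : (k < n.+1)%N by rewrite ltnS leq_maxl.
have Wn1 : 2 * cnorm (iter n.+1 W v) <= e.
  have dec := iter_decay n.+1 v C0 WC.
  have : 2 * D <= n.+2%:R * e.
    rewrite -ler_pdivrMr // (le_trans nn) // ler_nat //.
  rewrite -/D in dec => De.
  rewrite -(@ler_pM2l _ n.+2%:R) ?ltr0n // mulrCA.
  by rewrite (le_trans _ De) // ler_pM2l.
rewrite (le_trans (iter_le_ends (Ordinal kn) v)) //= mulrDr lerD2l.
exact: Wn1.
Qed.

(** The exponent [n] depends on [c] alone, whatever the power bound [C]. *)
Lemma iter_half n C v : 0 <= C ->
  (forall k v, cnorm (iter k W v) <= C * cnorm v) ->
  4 * ((1 + 2 * (2 / c)) / c) ^+ 2 <= n.+1%:R ->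
  2 * cnorm (iter n W v) <= cnorm v.
Proof.
move=> C0 WC hn; have c2 : 0 <= 2 / c by rewrite divr_ge0 // ltW.
have dec := iter_decay n v c2 (power_bounded_uniform C0 WC).
rewrite -(@ler_pM2l _ n.+1%:R) ?ltr0n // mulrCA.
have v0 := cnorm_ge0 v.
have := ler_wpM2r v0 hn; apply: le_trans.
move: dec; set q := _ ^+ 2; lra.
Qed.

End ResolventBounds.

(** * Compact operators without large eigenvalues *)

Section ComplexifyLinear.
Context {R : rcfType} {V : lmodType R} (T : {linear V -> V}).

Fact complexify_is_linear : linear (complexify T).
Proof.
move=> [a b] [u v] [u' v']; rewrite /complexify /=; congr pair => /=.
  by rewrite linearD linearB !linearZ.
by rewrite !linearD !linearZ.
Qed.

HB.instance Definition _ := GRing.isLinear.Build R[i] (complexification V)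
  (complexification V) *:%R (complexify T) complexify_is_linear.

Lemma iter_complexify k (w : complexification V) :
  iter k (complexify T) w = (iter k T w.1, iter k T w.2).
Proof. by elim: k => [|k /= ->] //; case: w. Qed.

End ComplexifyLinear.

Section CompactOperators.
Context {R : realType} {X : normedModType R} (S : {linear X -> X}).
Local Notation VC := (complexification X).

Lemma compact_map_bounded : compact_map S ->
  exists2 K : R, 0 < K & forall u, `|S u| <= K * `|u|.
Proof.
move=> /compact_bounded/ex_strict_bound_gt0[M M0 SM].
exists M => // u; have [->|u0] := eqVneq u 0.
  by rewrite linear0 !normr0 mulr0.
have nu : 0 < `|u| by rewrite normr_gt0.
have : `|S (`|u|^-1 *: u)| <= M.
  apply/ltW/SM/subset_closure; exists (`|u|^-1 *: u) => //=.
  by rewrite normrZ normfV normr_id mulVf // gt_eqF.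
by rewrite linearZ /= normrZ normfV normr_id mulrC ler_pdivrMr.
Qed.

Lemma cnorm_complexify_le K : (forall u, `|S u| <= K * `|u|) ->
  forall w, cnorm (complexify S w) <= K * cnorm w.
Proof. by move=> SK w; rewrite /cnorm mulrDr lerD //=; exact: SK. Qed.

Lemma compact_min_gt0 (P : topologicalType) (f : P -> R) (Q : set P) :
  compact Q -> continuous f -> (forall p, Q p -> 0 < f p) ->
  exists2 m, 0 < m & forall p, Q p -> m <= f p.
Proof.
move=> cQ cf f0; have [Q0|/set0P/negP] := pselect (Q !=set0); last first.
  by rewrite negbK => /eqP ->; exists 1 => // p [].
have [p /set_mem Qp pmin] := compact_EVT_min Q0 cQ (continuous_subspaceT cf).
by exists (f p); [exact: f0|move=> q /mem_set; exact: pmin].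
Qed.

(** If [w] is a unit vector with [(S - z) w] small, then [y = S w] stays in a compact
    set, is bounded away from 0 because [|z|] is, and has [(S - z) y] small too. But
    [(S - z) y] has a positive minimum over such pairs [z], [y], as none of them
    consists of an eigenvalue and an eigenvector. *)
Lemma compact_shift_below (s r : R) : 0 < s -> compact_map S ->
  (forall (z : R[i]) (w : VC), s <= normc z -> complexify S w = z *: w -> w = 0) ->
  exists2 c : R, 0 < c & forall (z : R[i]) (w : VC), s <= normc z <= r ->
    c * cnorm w <= cnorm (complexify S w - z *: w).
Proof.
move=> s0 cS noeig; have [K K0 SK] := compact_map_bounded cS.
have Scont : continuous S.
  apply/linear_bounded_continuous/linear_boundedP.
  exists K; split; first exact: num_real.
  by move=> M /ltW KM u; rewrite (le_trans (SK u)) // ler_wpM2r.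
pose B := closure (S @` [set x | `|x| <= 1]).
pose P := ((R * R) * (X * X))%type.
pose cz (p : P) : R[i] := (p.1.1 +i* p.1.2)%C.
pose cw (p : P) : VC := (p.2.1, p.2.2).
(* on vectors of norm at least s / 4 the minimum of f cannot vanish *)
pose Q : set P := ((`[-r, r] `*` `[-r, r]) `*` (B `*` B)) `&`
  ((fun p => normc (cz p)) @^-1` [set t | s <= t] `&`
   (fun p => cnorm (cw p)) @^-1` [set t | s / 4 <= t]).
have c11 : continuous (fun p : P => p.1.1).
  by move=> p; apply: (@cvg_comp _ _ _ fst fst); [exact: cvg_fst|exact: cvg_fst].
have c12 : continuous (fun p : P => p.1.2).
  by move=> p; apply: (@cvg_comp _ _ _ fst snd); [exact: cvg_fst|exact: cvg_snd].
have c21 : continuous (fun p : P => p.2.1).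
  by move=> p; apply: (@cvg_comp _ _ _ snd fst); [exact: cvg_snd|exact: cvg_fst].
have c22 : continuous (fun p : P => p.2.2).
  by move=> p; apply: (@cvg_comp _ _ _ snd snd); [exact: cvg_snd|exact: cvg_snd].
have Qcompact : compact Q.
  apply: compact_closedI.
    by apply: compact_setX; apply: compact_setX => //; exact: segment_compact.
  apply: closedI; apply: preimage_closed => //; try exact: closed_ge; move=> p _ /=.
    rewrite /normc /=; apply: continuous_comp; last exact: sqrt_continuous.
    by apply: cvgD; rewrite ?expr2; apply: cvgM; first [exact: c11|exact: c12].
  by apply: cvgD; apply: cvg_norm; [exact: c21|exact: c22].
pose f (p : P) : R := cnorm (complexify S (cw p) - cz p *: cw p).
have fcont : continuous f.
  move=> p; rewrite /f /cnorm /=; apply: cvgD; apply: cvg_norm; apply: cvgB.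
  - by apply: (continuous_comp (c21 p)); exact: Scont.
  - by apply: cvgB; apply: cvgZ; [exact: c11|exact: c21|exact: c12|exact: c22].
  - by apply: (continuous_comp (c22 p)); exact: Scont.
  - by apply: cvgD; apply: cvgZ; [exact: c11|exact: c22|exact: c12|exact: c21].
have fpos p : Q p -> 0 < f p.
  move=> [_ [/= sz sw]]; rewrite lt_def cnorm_ge0 andbT.
  apply/eqP => /cnorm_eq0/subr0_eq/(noeig (cz p) _ sz) w0.
  by move: sw; rewrite w0 cnorm0 leNgt divr_gt0.
have [m m0 mf] := compact_min_gt0 Qcompact fcont fpos.
exists (Num.min (s / 4) (m / K)); first by rewrite lt_min !divr_gt0.
move=> z w /andP[sz zr].
have [->|w0] := eqVneq w 0; first by rewrite cnorm0 mulr0 cnorm_ge0.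
pose N := cnorm w.
have N0 : 0 < N.
  by rewrite lt_def cnorm_ge0 andbT; apply: contra w0 => /eqP/cnorm_eq0 ->.
pose v := (N^-1)%:C%C *: w.
have v1 : cnorm v = 1.
  by rewrite cnormZ_real ger0_norm ?invr_ge0 ?cnorm_ge0 // mulVf // gt_eqF.
have shv : complexify S v - z *: v = (N^-1)%:C%C *: (complexify S w - z *: w).
  by rewrite linearZ /= scalerBr !scalerA mulrC.
suff : Num.min (s / 4) (m / K) <= cnorm (complexify S v - z *: v).
  rewrite shv cnormZ_real ger0_norm ?invr_ge0 ?cnorm_ge0 //.
  by rewrite [leRHS]mulrC ler_pdivlMr.
rewrite ge_min; have [//|/= near0] := leP (s / 4) (cnorm _).
(* y is almost an eigenvector for z, and its components lie in the compact set B *)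
pose y := complexify S v.
have ySv : complexify S y - z *: y = complexify S (y - z *: v).
  by rewrite [RHS]linearB; congr (_ - _); rewrite [RHS]linearZ.
rewrite ler_pdivrMr // mulrC (le_trans _ (cnorm_complexify_le SK _)) // -ySv.
apply: (mf ((complex.Re z, complex.Im z), (y.1, y.2))); split => /=.
  have := ge_Re_normc z; have := ge_Im_normc z; rewrite !in_itv /= -!ler_norml => Iz Rz.
  split; split; rewrite ?(le_trans Rz) ?(le_trans Iz) //.
    apply: subset_closure; exists v.1 => //=.
    by rewrite -v1 /cnorm lerDl.
  apply: subset_closure; exists v.2 => //=.
  by rewrite -v1 /cnorm lerDr.
split; first by case: z sz {zr shv near0 ySv}.
have : cnorm (z *: v) <= cnorm y + s / 4.
  have -> : z *: v = y - (y - z *: v) by rewrite subKr.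
  by rewrite (le_trans (cnormB _ _)) // lerD2l ltW.
have := cnormZ_ge z v; rewrite v1 mulr1 => h1 h2.
have -> : cw (complex.Re z, complex.Im z, (y.1, y.2)) = y by case: (y).
lra.
Qed.

End CompactOperators.

Section PowerBound.
Context {R : realType} {X : normedModType R} (S : {linear X -> X}).
Local Notation VC := (complexification X).

Definition power_bound (t : R) := exists2 C, 0 <= C &
  forall k (w : VC), cnorm (iter k (complexify S) w) <= C * t ^+ k * cnorm w.

Lemma power_bound_le t t' : 0 <= t <= t' -> power_bound t -> power_bound t'.
Proof.
move=> /andP[t0 tt'] [C C0 Ct]; exists C => // k w.
rewrite (le_trans (Ct k w)) // ler_wpM2r ?cnorm_ge0 // ler_wpM2l //.
by rewrite lerXn2r ?nnegrE // (le_trans t0).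
Qed.

(** Euclidean division of the exponent by [n]. *)
Lemma power_bound_root n t q : 0 < q <= t -> (0 < n)%N ->
  power_bound t ->
  (forall w : VC, cnorm (iter n (complexify S) w) <= q ^+ n * cnorm w) ->
  power_bound q.
Proof.
move=> /andP[q0 qt] n0 [C C0 Ct] Sn.
have t0 : 0 < t := lt_le_trans q0 qt.
have SnX k (w : VC) :
    cnorm (iter (k * n) (complexify S) w) <= q ^+ (k * n) * cnorm w.
  elim: k => [|k IH]; first by rewrite mul0n expr0 mul1r.
  rewrite mulSn iterD exprD -mulrA (le_trans (Sn _)) // ler_wpM2l //.
  by rewrite exprn_ge0 // ltW.
exists (C * (t / q) ^+ n) => [|k w].
  by rewrite mulr_ge0 // exprn_ge0 // divr_ge0 // ltW.
rewrite {1}(divn_eq k n) iterD (le_trans (SnX _ _)) //.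
have qk : q ^+ k = q ^+ (k %/ n * n) * q ^+ (k %% n) by rewrite -exprD -divn_eq.
rewrite qk [C * _ * _]mulrCA -mulrA ler_wpM2l ?exprn_ge0 ?(ltW q0) //.
rewrite (le_trans (Ct _ _)) // ler_wpM2r ?cnorm_ge0 // -mulrA ler_wpM2l //.
rewrite -ler_pdivrMr ?exprn_gt0 // -expr_div_n.
by rewrite ler_weXn2l ?ler_pdivlMr ?mul1r // ltnW // ltn_mod.
Qed.

(** The radii are lowered step by step. A power bound holds for the radius [s + K]
    because [|S u| <= K |u|]. On the annulus [s <= |z| <= s + K] the resolvent bound
    is uniform, so a power bound at a radius [t >= s] implies one at [th * t] with
    a factor [th < 1] independent of [t]. Finitely many steps lead down to [s]. *)
Lemma compact_power_bound (s : R) : 0 < s -> compact_map S ->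
  (forall (z : R[i]) (w : VC), s <= normc z -> complexify S w = z *: w -> w = 0) ->
  power_bound s.
Proof.
move=> s0 cS noeig; have [K K0 SK] := compact_map_bounded cS.
pose r := s + K.
have r0 : 0 < r by rewrite addr_gt0.
have [c1 c10 c1P] := compact_shift_below r s0 cS noeig.
pose c := c1 / (2 * r).
have c0 : 0 < c by rewrite divr_gt0 // mulr_gt0.
pose n := (Num.truncn (4 * ((1 + 2 * (2 / c)) / c) ^+ 2)).+1.
have nP : 4 * ((1 + 2 * (2 / c)) / c) ^+ 2 <= n.+1%:R.
  by apply/ltW/(lt_trans (truncnS_gt _)); rewrite ltr_nat.
have n0 : (0 < n)%N by [].
(* the n-th root of 1/2 turns the halving of iter_half into one power bound *)
pose th : R := 2^-1 `^ n%:R^-1.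
have thn : th ^+ n = 2^-1.
  by rewrite -powR_mulrn ?powR_ge0 // -powRrM mulVf ?pnatr_eq0 // powRr1.
have th0 : 0 < th by rewrite powR_gt0.
have th1 : th < 1.
  rewrite ltNge; apply/negP => /(exprn_ege1 n); rewrite thn leNgt.
  by rewrite invf_lt1 // ltr1n.
have step t : s <= t <= r -> power_bound t -> power_bound (th * t).
  move=> /andP[st tr] bt; have t0 : 0 < t := lt_le_trans s0 st.
  pose W : {linear VC -> VC} := (t^-1)%:C%C \*: complexify S.
  have iterW k (w : VC) :
      iter k W w = (t^-1 ^+ k)%:C%C *: iter k (complexify S) w.
    elim: k => [|k IH]; first by rewrite expr0 scale1r.
    by rewrite !iterS IH linearZ /= !scalerA -rmorphM /= mulrC exprS.
  have cW k (w : VC) :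
      t ^+ k * cnorm (iter k W w) = cnorm (iter k (complexify S) w).
    rewrite iterW cnormZ_real ger0_norm ?exprn_ge0 ?invr_ge0 ?(ltW t0) //.
    by rewrite mulrA -exprMn mulfV ?gt_eqF // expr1n mul1r.
  have Wbelow z (u : VC) : normc z = 1 -> c * cnorm u <= cnorm (u - z *: W u).
    move=> z1; have z0 : z != 0.
      by apply/eqP => z0; move: z1 => /eqP; rewrite z0 normc0 eq_sym oner_eq0.
    have nt (a : R) : 0 <= a -> normc a%:C%C = a.
      by move=> a0; rewrite /normc /= expr0n addr0 sqrtr_sqr ger0_norm.
    have -> : u - z *: W u =
        - ((z / t%:C%C) *: (complexify S u - (t%:C%C / z) *: u)).
      rewrite scalerBr !scalerA mulrA divfK ?mulfV //; last first.
        by rewrite eq_complex /= gt_eqF.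
      by rewrite scale1r opprB fmorphV.
    rewrite cnormN; set v := _ - _.
    have : normc (z / t%:C%C) * cnorm v <= 2 * cnorm ((z / t%:C%C) *: v).
      exact: cnormZ_ge.
    have : c1 * cnorm u <= cnorm v.
      by apply: c1P; rewrite normcM normcV z1 invr1 mulr1 nt ?(ltW t0) // st.
    rewrite normcM normcV nt ?(ltW t0) // z1 mul1r => h1.
    rewrite [leLHS]mulrC ler_pdivrMr // => h2.
    rewrite /c mulrAC ler_pdivrMr ?mulr_gt0 //.
    rewrite (le_trans h1) // (le_trans h2) //; set a := cnorm _.
    have : a * t <= a * r by rewrite ler_wpM2l ?cnorm_ge0.
    lra.
  case: (bt) => C C0 Ct.
  have WC k v : cnorm (iter k W v) <= C * cnorm v.
    rewrite -(@ler_pM2l _ (t ^+ k)) ?exprn_gt0 // cW (le_trans (Ct _ _)) //.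
    by rewrite mulrA [C * _]mulrC.
  apply: (power_bound_root _ n0 bt) => [|w].
    by rewrite mulr_gt0 //= ler_piMl ?(ltW t0) // ltW.
  have := iter_half c0 Wbelow w C0 WC nP.
  rewrite -cW exprMn thn -mulrA mulrCA => h.
  rewrite ler_wpM2l ?exprn_ge0 ?(ltW t0) //.
  by rewrite ler_pdivlMl.
have bmax j : power_bound (Num.max s (r * th ^+ j)).
  elim: j => [|j IH].
    rewrite expr0 mulr1; apply: (@power_bound_le K).
      by rewrite (ltW K0) le_max /r lerDr (ltW s0) orbT.
    exists 1 => // k w; rewrite mul1r; elim: k => [|k IH]; first by rewrite mul1r.
    rewrite iterS (le_trans (cnorm_complexify_le SK _)) // exprS -mulrA.
    by rewrite ler_wpM2l // ltW.
  have rj : r * th ^+ j <= r.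
    by rewrite ler_piMr ?(ltW r0) // exprn_ile1 // ltW.
  apply: power_bound_le (step _ _ IH); last first.
    by rewrite le_max lexx ge_max rj /r lerDl (ltW K0).
  apply/andP; split; first by rewrite mulr_ge0 ?(ltW th0) // le_max (ltW s0).
  rewrite maxr_pMr ?(ltW th0) // mulrCA -exprS ge_max le_max.
  by rewrite ler_piMl ?(ltW s0) ?(ltW th1) //= le_max lexx orbT.
have [j jP] : exists j, r * th ^+ j <= s.
  have : (fun j => th ^+ j) @ \oo --> (0 : R).
    by apply: cvg_expr; rewrite ger0_norm ?(ltW th0).
  move=> /cvgrPdist_le /(_ (s / r)); rewrite divr_gt0 // => /(_ isT)[j _ jP].
  exists j; have := jP j (leqnn j); rewrite /= sub0r normrN.
  by rewrite ger0_norm ?exprn_ge0 ?(ltW th0) // ler_pdivlMr // mulrC.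
by have := bmax j; rewrite max_l.
Qed.

End PowerBound.

(** * Expansion on generalized eigenvectors *)

Section LowerGrowth.
Context {R : realType} {X : normedModType R} (T : {linear X -> X}).
Local Notation VC := (complexification X).
Local Notation A := (complexify T).

(** Iteration of [w = z^-1 (T w - (T - z) w)]. *)
Lemma iter_backward (z : R[i]) (w : VC) k : z != 0 ->
  w = z ^- k *: iter k A w
      - \sum_(j < k) z ^- j.+1 *: iter j A (shift A z w).
Proof.
move=> z0; elim: k => [|k IH].
  by rewrite big_ord0 subr0 expr0 invr1 scale1r.
rewrite {1}IH big_ord_recr /= opprD [X in _ = _ + X]addrC addrA.
congr (_ - _).
rewrite -shift_iterT /shift scalerBr opprB addrC subrK.
by rewrite scalerA exprS invfM mulrAC mulVf ?mul1r.
Qed.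

(** Induction on the product. The vector [(T - z) w] is killed by a shorter product,
    so its orbit is controlled by its last term; [iter_backward] then bounds [w] by
    [T^k w] and a geometric series of ratio [rho / |z| < 1]. *)
Lemma spectral_lower_growth (K rho r : R) (s : seq R[i]) :
  0 <= K -> (forall u, `|T u| <= K * `|u|) -> 0 < rho < r ->
  all (fun z => r <= normc z) s ->
  exists2 C, 0 < C & forall k w, shifts A s w = 0 ->
    rho ^+ k * cnorm w <= C * cnorm (iter k A w).
Proof.
move=> K0 TK /andP[rho0 rhor]; elim: s => [_|z s IH /= /andP[rz sr]].
  by exists 1 => // k w /= ->; rewrite cnorm0 mulr0 mul1r cnorm_ge0.
have [C C0 CP] := IH sr.
set n := normc z in rz.
have n0 : 0 < n by apply: lt_trans (lt_le_trans rhor rz).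
have z0 : z != 0 by apply: contraTneq n0 => z0; rewrite /n z0 normc0 ltxx.
have nX k : normc (z ^- k) = n ^- k by rewrite normcV normcX.
pose D := C * (K + 2 * n).
have D0 : 0 <= D by rewrite mulr_ge0 ?addr_ge0 ?mulr_ge0 ?(ltW C0) ?(ltW n0).
have rn : rho < n := lt_le_trans rhor rz.
have nr : 0 < n - rho by rewrite subr_gt0.
exists (2 + 2 * D / (n - rho)) => [|k w].
  by apply: ltr_wpDr => //; apply: divr_ge0; [exact: mulr_ge0|exact: ltW].
rewrite -shifts_shift => sw; set N := cnorm (iter k A w).
have N0 : 0 <= N := cnorm_ge0 _.
pose q := rho / n.
have q0 : 0 <= q by rewrite divr_ge0 // ltW.
have q1 : q < 1 by rewrite ltr_pdivrMr // mul1r.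
have past (j : 'I_k) : rho ^+ (k - j) * cnorm (iter j A (shift A z w)) <= D * N.
  have jk : (j <= k)%N by apply/ltnW/ltn_ord.
  have sj : shifts A s (iter j A (shift A z w)) = 0.
    elim: (nat_of_ord j) => [|i ih]; first exact: sw.
    have -> : iter i.+1 A (shift A z w) = shift A 0 (iter i A (shift A z w)).
      by rewrite /shift scale0r subr0.
    by rewrite shifts_shift ih linear0.
  rewrite (le_trans (CP _ _ sj)) // -iterD subnK // -shift_iterT -mulrA.
  rewrite ler_pM2l // (le_trans (cnormB _ _)) // mulrDl.
  by rewrite lerD ?cnormZ_le // cnorm_complexify_le.
have term (j : 'I_k) :
    rho ^+ k * cnorm (z ^- j.+1 *: iter j A (shift A z w)) <=
    2 * D / n * N * q ^+ j.
  have jk : (j <= k)%N by apply/ltnW/ltn_ord.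
  rewrite (@le_trans _ _ (rho ^+ k * (2 * n ^- j.+1 *
      cnorm (iter j A (shift A z w))))) //.
    by rewrite ler_pM2l ?exprn_gt0 // (le_trans (cnormZ_le _ _)) // nX.
  have -> : rho ^+ k = rho ^+ (k - j) * rho ^+ j by rewrite -exprD subnK.
  have := past j; set a := rho ^+ (k - j); set b := cnorm _ => ab.
  rewrite [leLHS](_ : _ = 2 / n * q ^+ j * (a * b)); last first.
    by rewrite /q expr_div_n exprS invfM; ring.
  rewrite [leRHS](_ : _ = 2 / n * q ^+ j * (D * N)); last by ring.
  by rewrite ler_wpM2l // !mulr_ge0 ?exprn_ge0 ?invr_ge0 // ltW.
have first_term : rho ^+ k * cnorm (z ^- k *: iter k A w) <= 2 * N.
  rewrite (@le_trans _ _ (rho ^+ k * (2 * n ^- k * N))) //.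
    by rewrite ler_pM2l ?exprn_gt0 // (le_trans (cnormZ_le _ _)) // nX.
  rewrite [leLHS](_ : _ = q ^+ k * (2 * N)); last first.
    by rewrite /q expr_div_n; ring.
  by rewrite ler_piMl ?mulr_ge0 // exprn_ile1 // ltW.
rewrite [w in leLHS](iter_backward w k z0).
rewrite (@le_trans _ _ (rho ^+ k * (cnorm (z ^- k *: iter k A w) +
  \sum_(j < k) cnorm (z ^- j.+1 *: iter j A (shift A z w))))) //.
  rewrite ler_pM2l ?exprn_gt0 // (le_trans (cnormB _ _)) // lerD2l.
  exact: cnorm_sum.
rewrite mulrDr mulrDl lerD // mulr_sumr.
rewrite (le_trans (ler_sum _ (fun j _ => term j))) //= -mulr_sumr.
have geo : (n - rho) * \sum_(j < k) q ^+ j <= n.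
  have -> : n - rho = n * (1 - q).
    by rewrite mulrBr mulr1 /q mulrCA mulfV ?mulr1 ?gt_eqF.
  rewrite -mulrA -opprB mulNr -subrX1 opprB ler_piMr ?(ltW n0) //.
  by rewrite gerBl exprn_ge0.
move: geo; set g := \sum_(j < k) _ => geo.
rewrite [leLHS](_ : _ = 2 * D * N * (g / n)); last by ring.
rewrite [leRHS](_ : _ = 2 * D * N * (n - rho)^-1); last by ring.
apply: ler_wpM2l; first by apply: mulr_ge0 => //; exact: mulr_ge0.
rewrite ler_pdivrMr // [leRHS]mulrC.
by rewrite ler_pdivlMr // mulrC.
Qed.

End LowerGrowth.

(** * Smooth norms and norming functionals *)

Section NormDerivative.
Context {R : realType} {X : normedModType R}.
Hypothesis smoothX : uniformly_smooth X.

Definition norm_slope (z h : X) (t : R) : R := (`|z + t *: h| - `|z|) / t.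

(** The right derivative at [0] of [t |-> |z + t h|]: the slopes of a convex
    function are nondecreasing, so that their limit is an infimum. *)
Definition norm_deriv (z h : X) : R :=
  inf [set norm_slope z h t | t in [set t | 0 < t]].

Lemma norm_slope_ge z h t : 0 < t -> - `|h| <= norm_slope z h t.
Proof.
move=> t0; rewrite ler_pdivlMr //.
have := ler_normB (z + t *: h) (t *: h).
rewrite addrK normrZ (gtr0_norm t0); lra.
Qed.

Lemma norm_deriv_has_inf z h :
  has_inf [set norm_slope z h t | t in [set t | 0 < t]].
Proof.
split; first by exists (norm_slope z h 1), 1 => //=.
by exists (- `|h|) => _ [t t0 <-]; exact: norm_slope_ge.
Qed.

Lemma norm_deriv_le z h t : 0 < t -> norm_deriv z h <= norm_slope z h t.
Proof. by move=> t0; apply: ge_inf; [case: (norm_deriv_has_inf z h)|exists t]. Qed.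

Lemma le_norm_deriv z h b :
  (forall t, 0 < t -> b <= norm_slope z h t) -> b <= norm_deriv z h.
Proof.
move=> bP; apply: lb_le_inf; first by case: (norm_deriv_has_inf z h).
by move=> _ [t t0 <-]; exact: bP.
Qed.

Lemma norm_deriv_ge z h : - `|h| <= norm_deriv z h.
Proof. by apply: le_norm_deriv => t; exact: norm_slope_ge. Qed.

(** Convexity: with [u = s t / (s + t)], the point [z + u (h + k)] is a barycentre of
    [z + s h] and [z + t k]. *)
Lemma norm_deriv_subadd z h k :
  norm_deriv z (h + k) <= norm_deriv z h + norm_deriv z k.
Proof.
rewrite -lerBlDr; apply: le_norm_deriv => s s0; rewrite lerBlDl -lerBlDr.
apply: le_norm_deriv => t t0; rewrite lerBlDr.
have st0 : 0 < s + t by rewrite addr_gt0.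
have u0 : 0 < s * t / (s + t) by rewrite divr_gt0 // mulr_gt0.
rewrite (le_trans (norm_deriv_le _ _ u0)) //.
rewrite /norm_slope ler_pdivrMr // lerBlDr.
have -> : z + (s * t / (s + t)) *: (h + k) =
    (t / (s + t)) *: (z + s *: h) + (s / (s + t)) *: (z + t *: k).
  rewrite !scalerDr !scalerA addrACA -scalerDl -mulrDl [t + s]addrC divff ?gt_eqF //.
  by rewrite scale1r; congr (_ + (_ *: _ + _ *: _)); ring.
rewrite (le_trans (ler_normD _ _)) // !normrZ !gtr0_norm ?divr_gt0 ?invr_gt0 //.
set a := `|z + s *: h|; set b := `|z + t *: k|; set n := `|z|.
rewrite le_eqVlt; apply/orP; left; apply/eqP.
by field; rewrite !gt_eqF.
Qed.

Lemma norm_derivZ z h a : 0 < a -> norm_deriv z (a *: h) = a * norm_deriv z h.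
Proof.
have scale b k : 0 < b -> b * norm_deriv z k <= norm_deriv z (b *: k).
  move=> b0; apply: le_norm_deriv => t t0.
  have tb : 0 < t * b by rewrite mulr_gt0.
  rewrite mulrC -ler_pdivlMr // (le_trans (norm_deriv_le _ _ tb)) //.
  by rewrite /norm_slope scalerA invfM mulrA.
move=> a0; apply/le_anti; rewrite scale // andbT.
have := @scale a^-1 (a *: h); rewrite invr_gt0 scalerA mulVf ?gt_eqF // scale1r.
by move=> /(_ a0); rewrite ler_pdivrMl.
Qed.

Lemma norm_deriv0 z : norm_deriv z 0 = 0.
Proof.
have := norm_deriv_ge z 0; rewrite normr0 oppr0 => ge0.
apply/le_anti; rewrite ge0 andbT.
rewrite (le_trans (norm_deriv_le _ _ ltr01)) //.
by rewrite /norm_slope scaler0 addr0 subrr mul0r.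
Qed.

(** Subadditivity gives one inequality; uniform smoothness says that the sum of the
    slopes in the directions [h] and [- h] tends to 0, which is the other one. *)
Lemma norm_derivN z h : `|z| = 1 -> norm_deriv z (- h) = - norm_deriv z h.
Proof.
move=> z1; apply/le_anti; apply/andP; split; last first.
  by rewrite -subr_ge0 opprK -(norm_deriv0 z) -(addNr h) norm_deriv_subadd.
rewrite -subr_le0 opprK.
have [->|h0] := eqVneq h 0; first by rewrite oppr0 norm_deriv0 addr0.
have nh : 0 < `|h| by rewrite normr_gt0.
apply/ler_addgt0Pr => e e0; rewrite add0r.
have [|d d0 dP] := smoothX (e := e / (2 * `|h|)); first by rewrite divr_gt0 // mulr_gt0.
(* the step for which the increment t *: h has norm d *)
pose t := d / `|h|.
have t0 : 0 < t by rewrite divr_gt0.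
rewrite (le_trans (lerD (norm_deriv_le _ _ t0) (norm_deriv_le _ _ t0))) //.
have := dP z (t *: h) z1; rewrite normrZ gtr0_norm // divfK ?gt_eqF // => /(_ (lexx _)).
rewrite /norm_slope z1 scalerN -mulrDl ler_pdivrMr // /t.
set a := `|_ + _|; set b := `|_ - _|.
have -> : e / (2 * `|h|) * d = e * (d / `|h|) / 2 by field; rewrite gt_eqF.
lra.
Qed.

Lemma norm_deriv_linear z : `|z| = 1 -> linear (norm_deriv z : X -> R^o).
Proof.
move=> z1.
have add h k : norm_deriv z (h + k) = norm_deriv z h + norm_deriv z k.
  apply/le_anti; rewrite norm_deriv_subadd /= -lerBrDr -norm_derivN //.
  by rewrite -[h in leLHS](addrK k) norm_deriv_subadd.
move=> a h k; rewrite add; congr (_ + _).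
have [a0|a0|->] := ltrgtP a 0; last by rewrite !scale0r norm_deriv0.
  rewrite -[a]opprK scaleNr norm_derivN // norm_derivZ ?oppr_gt0 //.
  by rewrite -mulNr.
by rewrite norm_derivZ.
Qed.

Lemma norm_deriv_self z : `|z| = 1 -> norm_deriv z z = 1.
Proof.
move=> z1; have slope t : 0 < t -> norm_slope z z t = 1.
  move=> t0; rewrite /norm_slope -{1}[z]scale1r -scalerDl normrZ z1 mulr1.
  by rewrite gtr0_norm ?addr_gt0 // [1 + t]addrC addrK divff // gt_eqF.
apply/le_anti/andP; split; first by rewrite -(slope 1) // norm_deriv_le.
by apply: le_norm_deriv => t t0; rewrite slope.
Qed.

Lemma norm_deriv_bound z h : `|z| = 1 -> `|norm_deriv z h| <= `|h|.
Proof.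
move=> z1; rewrite ler_norml norm_deriv_ge /= -(lerN2 `|h|) -norm_derivN //.
by rewrite -(normrN h) norm_deriv_ge.
Qed.

End NormDerivative.

Section OperatorNorm.
Context {R : realType} {X Y : normedModType R} (S : {linear X -> Y}) (K : R).
Hypothesis SK : forall u, `|S u| <= K * `|u|.

Lemma opnorm_on_has_sup (D : set X) : D 0 ->
  has_sup [set `|S u| | u in D `&` [set u | `|u| <= 1]].
Proof.
move=> D0; split; first by exists `|S 0|, 0 => //; split=> //=; rewrite normr0.
exists `|K| => _ [u [_ /= u1] <-].
rewrite (le_trans (SK u)) // (le_trans (ler_wpM2r _ (ler_norm K))) //.
by rewrite ler_piMr.
Qed.

Lemma le_opnorm_on (D : set X) u : D 0 -> (forall a v, D v -> D (a *: v)) ->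
  D u -> `|S u| <= opnorm_on D S * `|u|.
Proof.
move=> D0 DZ Du; have [->|u0] := eqVneq u 0.
  by rewrite linear0 !normr0 mulr0.
have nu : 0 < `|u| by rewrite normr_gt0.
rewrite -ler_pdivrMr //.
have -> : `|S u| / `|u| = `|S (`|u|^-1 *: u)|.
  by rewrite linearZ /= normrZ normfV normr_id mulrC.
apply: ub_le_sup; first by case: (opnorm_on_has_sup D0).
exists (`|u|^-1 *: u) => //; split; first exact: DZ.
by rewrite /= normrZ normfV normr_id mulVf // gt_eqF.
Qed.

Lemma opnorm_on_le (D E : set X) : D 0 -> D `<=` E ->
  opnorm_on D S <= opnorm_on E S.
Proof.
move=> D0 DE; apply: ge_sup; first by case: (opnorm_on_has_sup D0).
move=> _ [u [Du u1] <-]; apply: ub_le_sup.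
  by case: (opnorm_on_has_sup (DE _ D0)).
by exists u => //; split=> //; exact: DE.
Qed.

End OperatorNorm.

Section Norming.
Context {R : realType} {X : normedModType R}.

Lemma dual_norm_bound (f : X -> R^o) u : dual f -> `|f u| <= dual_norm f * `|u|.
Proof.
move=> [fL fc].
pose g : {linear X -> R^o} := HB.pack f (GRing.isLinear.Build _ _ _ _ f fL).
have /linear_boundedP[K [Kr gK]] :=
  continuous_linear_bounded 0 (fc 0 : {for 0, continuous g}).
apply: (@le_opnorm_on _ _ _ g (K + 1)) => //.
by apply: gK; rewrite ltrDl.
Qed.

Lemma norming_bound (z : X) f : norming_set z f -> forall u, `|f u| <= `|u|.
Proof. by move=> [df f1 _] u; rewrite -[leRHS]mul1r -f1 dual_norm_bound. Qed.

Lemma norming_set_nonempty (z : X) : uniformly_smooth X -> z != 0 ->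
  norming_set z !=set0.
Proof.
move=> smX z0; have nz : 0 < `|z| by rewrite normr_gt0.
pose v := `|z|^-1 *: z.
have v1 : `|v| = 1 by rewrite normrZ normfV normr_id mulVf // gt_eqF.
pose f : X -> R^o := norm_deriv v.
have fL : linear f := norm_deriv_linear smX v1.
pose g : {linear X -> R^o} := HB.pack f (GRing.isLinear.Build _ _ _ _ f fL).
have fb u : `|g u| <= 1 * `|u| by rewrite mul1r; exact: norm_deriv_bound.
have fv : g v = 1 := norm_deriv_self v1.
exists f; split.
- split => //; apply: (@linear_bounded_continuous _ _ _ g).1.
  apply/linear_boundedP; exists 1; split; first exact: num_real.
  by move=> M /ltW M1 u; rewrite (le_trans (fb u)) // ler_wpM2r.
- apply/le_anti/andP; split.
    apply: ge_sup; first by case: (opnorm_on_has_sup fb (I : [set: X] 0)).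
    by move=> _ [u [_ /= u1] <-]; rewrite (le_trans (fb u)) // mul1r.
  have := le_opnorm_on fb (I : [set: X] 0) (fun _ _ _ => I) (I : [set: X] v).
  by rewrite fv normr1 v1 mulr1.
- have -> : z = `|z| *: v by rewrite scalerA mulfV ?gt_eqF // scale1r.
  have -> : f (`|z| *: v) = `|z| * g v by rewrite -[f]/(g : X -> R^o) linearZ.
  by rewrite fv mulr1 normrZ v1 mulr1 normr_id.
Qed.

Lemma JtildeP (z : X) : uniformly_smooth X -> z != 0 ->
  norming_set z (Jtilde z).
Proof.
by move=> smX z0; have [f fP] := norming_set_nonempty smX z0; apply: getI fP.
Qed.

Lemma J_linear mu (z : X) : uniformly_smooth X ->
  forall a u w, J mu z (a *: u + w) = a * J mu z u + J mu z w.
Proof.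
move=> smX a u w; rewrite /J; case: eqVneq => [_|z0]; first by rewrite mulr0 addr0.
have [[JL _] _ _] := JtildeP smX z0; rewrite JL mulrDr.
by rewrite -[_ *: _]/(_ * _) mulrCA.
Qed.

(** As [|z - t h| >= f (z - t h) = 1], smoothness leaves [|z + t h|] no room to exceed
    1 by more than a small multiple of [t]. *)
Lemma norm_perp_smooth (z h : X) f (e : R) : uniformly_smooth X -> `|z| = 1 ->
  norming_set z f -> f h = 0 -> 0 < e ->
  exists2 d : R, 0 < d & forall t : R, `|t| <= d -> `|z + t *: h| <= 1 + e * `|t|.
Proof.
move=> smX z1 zf fh e0.
have [->|h0] := eqVneq h 0.
  by exists 1 => // t _; rewrite scaler0 addr0 z1 lerDl mulr_ge0 // ltW.
have nh : 0 < `|h| by rewrite normr_gt0.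
have [|d d0 dP] := smX (e / (2 * `|h|)); first by rewrite divr_gt0 // mulr_gt0.
exists (d / `|h|); first by rewrite divr_gt0.
move=> t; rewrite ler_pdivlMr // => td.
have := dP z (t *: h) z1; rewrite normrZ => /(_ td).
have fz : 1 <= `|z - t *: h|.
  have [[fL _] _ fzz] := zf; rewrite (le_trans _ (norming_bound zf _)) //.
  have -> : f (z - t *: h) = 1.
    by rewrite addrC -scaleNr fL fh scaler0 add0r fzz.
  by rewrite normr1.
have -> : e / (2 * `|h|) * (`|t| * `|h|) = e * `|t| / 2 by field; rewrite gt_eqF.
lra.
Qed.

(** First-order condition at a maximizer [z] of [|S u| / |u|]: to first order
    [|z + t h|] does not vary, while [|S (z + t h)|] grows at least like [t * g (S h)]
    for either sign of [t]. *)
Lemma norming_extremal (S : {linear X -> X}) (D : set X) (l : R) z h f g :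
  uniformly_smooth X ->
  (forall u, D u -> `|S u| <= l * `|u|) -> (forall t, D (z + t *: h)) ->
  `|z| = 1 -> `|S z| = l -> norming_set z f -> f h = 0 ->
  norming_set (S z) g -> g (S h) = 0.
Proof.
move=> smX SD Dzh z1 Sz zf fh Szg.
have l0 : 0 <= l by rewrite -Sz.
have [[gL _] _ gSz] := Szg.
have line (t : R) : l + t * g (S h) <= l * `|z + t *: h|.
  have -> : l + t * g (S h) = g (S (z + t *: h)).
    by rewrite [z + _]addrC linearP gL gSz Sz addrC.
  rewrite (le_trans (ler_norm _)) // (le_trans (norming_bound Szg _)) //.
  exact: SD.
suff small (e : R) : 0 < e -> `|g (S h)| <= 0 + l * e.
  apply/eqP; rewrite -normr_le0; apply/ler_addgt0Pr => e e0.
  have l1 : 0 < l + 1 by rewrite ltr_wpDl.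
  rewrite (le_trans (small (e / (l + 1)) _)) ?divr_gt0 // lerD2l.
  by rewrite mulrCA ler_piMr ?(ltW e0) // ler_pdivrMr // mul1r lerDl.
move=> e0; rewrite add0r.
have [d d0 dP] := norm_perp_smooth smX z1 zf fh e0.
have bnd (t : R) : `|t| = d -> t * g (S h) <= l * (e * d).
  move=> td; have := line t.
  have td' : `|t| <= d by rewrite td.
  have := ler_wpM2l l0 (dP t td').
  by rewrite td; lra.
have dn : d * `|g (S h)| <= d * (l * e).
  rewrite [leRHS]mulrCA [d * e]mulrC.
  have [gp|gn] := leP 0 (g (S h)).
    by rewrite (ger0_norm gp) bnd // gtr0_norm.
  by rewrite (ltr0_norm gn) mulrN -mulNr bnd // normrN gtr0_norm.
by rewrite -(ler_pM2l d0).
Qed.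

End Norming.

(** * Triangular systems of norming functionals *)

Section Triangular.
Context {R : realType} {X : normedModType R}.

(** Row [i] of the triangular matrix [g i (S (x j))] has diagonal entry [|S (x i)|],
    and its entry in column [j] is at most [|S (x j)|]. Forward substitution doubles
    the bound at every row. *)
Lemma triangular_lower_bound (n : nat) (S : {linear X -> X}) (x : nat -> X)
    (g : nat -> X -> R^o) (c : nat -> R) :
  (forall i, norming_set (S (x i)) (g i)) ->
  (forall i j, (i < j)%N -> g i (S (x j)) = 0) ->
  forall i, (i <= n)%N ->
  `|S (x i)| * `|c i| <= 2 ^+ i * `|S (\sum_(j < n.+1) c j *: x j)|.
Proof.
move=> gP g0; set z := \sum_(_ < _) _.
elim/ltn_ind => i IH iN.
have [[gL _] _ gi] := gP i.
pose gi' : {linear X -> R^o} := HB.pack (g i) (GRing.isLinear.Build _ _ _ _ (g i) gL).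
have gSZ a u : g i (S (a *: u)) = a * g i (S u).
  by rewrite -[LHS]/(gi' (S (a *: u))) !linearZ.
have giSz : g i (S z) = \sum_(j < i) c j * g i (S (x j)) + c i * `|S (x i)|.
  rewrite -[LHS]/(gi' (S z)) /z !linear_sum.
  rewrite -(big_mkord xpredT (fun j => gi' (S (c j *: x j)))).
  have tail : \sum_(i.+1 <= j < n.+1) gi' (S (c j *: x j)) = 0.
    rewrite big_nat_cond big1 // => j /andP[/andP[ij _] _].
    by rewrite -[LHS]/(g i _) gSZ g0 // mulr0.
  rewrite (@big_cat_nat _ _ _ i.+1) //= tail addr0.
  rewrite big_mkord big_ord_recr /= gSZ gi.
  by congr (_ + _); apply: eq_bigr => j _; rewrite gSZ.
have sum_lt : \sum_(j < i) `|c j| * `|S (x j)| <= (2 ^+ i - 1) * `|S z|.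
  have -> : 2 ^+ i - 1 = \sum_(j < i) 2 ^+ j :> R.
    by rewrite subrX1 (_ : 2 - 1 = 1) ?mul1r //; ring.
  rewrite mulr_suml; apply: ler_sum => j _; rewrite mulrC IH //.
  by rewrite (leq_trans _ iN) // ltnW.
have : `|c i| * `|S (x i)| <= `|S z| + \sum_(j < i) `|c j| * `|S (x j)|.
  have -> : `|c i| * `|S (x i)| = `|g i (S z) - \sum_(j < i) c j * g i (S (x j))|.
    by rewrite giSz addrC addKr normrM normr_id.
  rewrite (le_trans (ler_normB _ _)) // lerD //; first exact: norming_bound (gP i) _.
  rewrite (le_trans (ler_norm_sum _ _ _)) //; apply: ler_sum => j _.
  by rewrite normrM ler_wpM2l // (norming_bound (gP i)).
rewrite [leLHS]mulrC; move: sum_lt; lra.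
Qed.

End Triangular.

(** * Counting eigenvalues with multiplicity *)

Section Counting.

Lemma card_eq_uniq (l : seq nat) : uniq l -> ([set` l] #= `I_(size l))%card.
Proof.
move=> ul; apply/card_esym/card_set_bijP; exists (nth 0%N l); split.
- by move=> i /= il; exact: mem_nth.
- move=> i j /set_mem /= il /set_mem /= jl /eqP.
  by rewrite nth_uniq // => /eqP.
- by move=> y /= yl; exists (index y l); rewrite /= ?index_mem ?nth_index.
Qed.

Lemma sum_count_mem (T : eqType) (L s : seq T) : uniq L ->
  (\sum_(z <- L) count_mem z s = count (mem L) s)%N.
Proof.
elim: L => [_|z L IH /= /andP[zL uL]]; first by rewrite big_nil count_pred0.
rewrite big_cons IH // -count_predUI [X in (_ + X)%N](_ : _ = 0)%N ?addn0.
  by apply: eq_count => y; rewrite /= inE.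
apply/eqP; rewrite -leqn0 leqNgt -has_count; apply/hasPn => y _ /=.
by apply: contra zL => /andP[/eqP ->].
Qed.

End Counting.

Section EigenvalueCount.
Context {R : realType} {V : lmodType R} (T : {linear V -> V}) (lam : nat -> R[i]).
Hypothesis lamP : eigenvalue_sequence T lam.
Local Notation A := (complexify T).

Lemma Re_norm (z : R[i]) : complex.Re `|z| = normc z.
Proof. by case: z. Qed.

Lemma lam_noninc i j : (i <= j)%N -> normc (lam j) <= normc (lam i).
Proof.
elim: j => [|j IH]; first by rewrite leqn0 => /eqP ->.
rewrite leq_eqVlt ltnS => /orP[/eqP -> //|/IH]; apply: le_trans.
by rewrite -!Re_norm; exact: lamP.1.
Qed.

Lemma generalized_eigenspaceE z :
  generalized_eigenspace T z = spectral A (pred1 z).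
Proof. by apply/seteqP; split => w /spectral_pred1. Qed.

Definition occurrences n (z : R[i]) := [seq i <- iota 0 n | lam i == z].

Lemma size_occurrences n z :
  size (occurrences n z) = count_mem z [seq lam i | i <- iota 0 n].
Proof. by rewrite size_filter count_map. Qed.

Lemma has_dim_occurrences n z : normc (lam n) < normc z ->
  has_dim (spectral A (pred1 z)) (size (occurrences n z)).
Proof.
move=> nz; rewrite -generalized_eigenspaceE; apply/lamP.2.
  by apply: contraTneq nz => ->; rewrite normc0 ltNge normc_ge0.
have -> : [set i | lam i = z] = [set` occurrences n z].
  apply/seteqP; split => i /=; rewrite mem_filter mem_iota /= add0n.
    move=> iz; rewrite iz eqxx /= ltnNge; apply/negP => /lam_noninc.
    by rewrite iz leNgt nz.
  by move=> /andP[/eqP].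
by apply: card_eq_uniq; rewrite filter_uniq ?iota_uniq.
Qed.

(** A generalized eigenspace with too few independent vectors would have a basis,
    whose size contradicts the multiplicity. This covers generalized eigenspaces
    of infinite dimension as well. *)
Lemma has_indep_occurrences n z : z != 0 ->
  has_indep (spectral A (pred1 z)) (size (occurrences n z)).
Proof.
move=> z0.
have [//|[m mn]] := indep_or_has_dim (size (occurrences n z))
  (spectral0 A (pred1 z)) (@spectralP _ _ A (pred1 z)).
rewrite -generalized_eigenspaceE => /(lamP.2 z z0) card_m.
have : ([set` occurrences n z] #<= [set i | lam i = z])%card.
  by apply: subset_card_le => i /=; rewrite mem_filter => /andP[/eqP].
have uocc : uniq (occurrences n z) by rewrite filter_uniq ?iota_uniq.
rewrite (card_le_eql (card_eq_uniq uocc)) (card_le_eqr card_m) card_le_II.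
by rewrite leqNgt mn.
Qed.

(** An eigenvalue of modulus above [|lam n|] occurs in [lam] only before the index
    [n], so the multiplicities of all of them add up to at most [n]. *)
Lemma spectral_spanned_gt n :
  exists2 m, (m <= n)%N &
    spanned_by (spectral A [pred z | normc (lam n) < normc z]) m.
Proof.
pose s := [seq lam i | i <- iota 0 n].
pose L := undup [seq z <- s | normc (lam n) < normc z].
have uL : uniq L := undup_uniq _.
have mL z : (z \in L) = (normc (lam n) < normc z) && (z \in s).
  by rewrite mem_undup mem_filter.
exists (\sum_(z <- L) count_mem z s)%N.
  rewrite sum_count_mem // (leq_trans (count_size _ _)) //.
  by rewrite size_map size_iota.
have [|b bP] := @spectral_spanned _ _ A L (fun z => count_mem z s) uL.
  move=> z; rewrite mL => /andP[nz _].
  have [v [_ vE]] := has_dim_occurrences nz.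
  by exists (v \o cast_ord (esym (size_occurrences n z))) => w; rewrite -vE => -[c ->];
    exists (c \o cast_ord (esym (size_occurrences n z)));
    rewrite (reindex (cast_ord (esym (size_occurrences n z)))) //=;
    exists (cast_ord (size_occurrences n z)) => i _; rewrite ?cast_ordK ?cast_ordKV.
exists b => w /(spectral_filter _) Zw; apply/bP/Zw => z v /= nz.
rewrite mL nz /= => zs vz.
have := has_dim_occurrences nz.
have -> : size (occurrences n z) = 0%N.
  by rewrite size_occurrences; apply/count_memPn.
move=> [b0 [_ b0E]].
have : spectral A (pred1 z) v by exists [:: z]; rewrite //= eqxx.
by rewrite -b0E => -[c ->]; rewrite big_ord0.
Qed.

(** The terms [lam 0, ..., lam n], counted with multiplicity, contribute [n + 1]
    generalized eigenvectors. *)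
Lemma spectral_indep_ge n : lam n != 0 ->
  has_indep (spectral A [pred z | normc (lam n) <= normc z]) n.+1.
Proof.
move=> ln0; pose s := [seq lam i | i <- iota 0 n.+1]; pose L := undup s.
have nlam0 : 0 < normc (lam n).
  by rewrite lt_def normc_ge0 andbT; apply: contra ln0 => /eqP/eq0_normc ->.
have Lge z : z \in L -> normc (lam n) <= normc z.
  rewrite mem_undup => /seq.mapP[j]; rewrite mem_iota add0n ltnS => /andP[_ ile] ->.
  exact: lam_noninc.
have [|v vI vL] := @spectral_has_indep _ _ A L (fun z => count_mem z s) (undup_uniq _).
  move=> z zL; rewrite -size_occurrences; apply: has_indep_occurrences.
  by apply: contraTneq (lt_le_trans nlam0 (Lge z zL)) => ->; rewrite normc0 ltxx.
have sz : (\sum_(z <- L) count_mem z s = n.+1)%N.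
  rewrite sum_count_mem ?undup_uniq // -[RHS](size_iota 0) -(size_map lam) -/s.
  by apply/eqP; rewrite -all_count; apply/allP => z; rewrite /= mem_undup.
rewrite -sz; exists v => // i; apply: sub_spectral (vL i) => z; exact: Lge.
Qed.

End EigenvalueCount.

(** * The j-eigenvalues of an injective operator *)

Section JEigen.
Context {R : realType} {X : normedModType R} (mu : R -> R) (S : {linear X -> X})
  (K : R) (x : nat -> X).
Hypotheses (smX : uniformly_smooth X) (infX : infinite_dimensional X).
Hypotheses (mu1 : mu 1 = 1) (SK : forall u, `|S u| <= K * `|u|).
Hypothesis Sinj : forall u, S u = 0 -> u = 0.
Hypothesis xP : jeigenvectors mu S x.

Lemma jspace0 n : jspace mu x n 0.
Proof.
by move=> i _; apply: scalar_map0; exact: J_linear.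
Qed.

Lemma jspaceP n a u w :
  jspace mu x n u -> jspace mu x n w -> jspace mu x n (a *: u + w).
Proof.
by move=> nu nw i iN; rewrite J_linear // nu // nw // mulr0 addr0.
Qed.

Lemma jspaceZ n a u : jspace mu x n u -> jspace mu x n (a *: u).
Proof. by move=> nu; rewrite -[_ *: _]addr0; apply: jspaceP => //; exact: jspace0. Qed.

Lemma le_jeigenvalue n u : jspace mu x n u ->
  `|S u| <= jeigenvalue mu S x n * `|u|.
Proof.
move=> nu; apply: (le_opnorm_on SK) => // [|a v].
  exact: jspace0.
exact: jspaceZ.
Qed.

Lemma jeigenvalue_ge0 n : 0 <= jeigenvalue mu S x n.
Proof.
rewrite -(normr0 X) -(linear0 S); apply: ub_le_sup.
  by case: (opnorm_on_has_sup SK (@jspace0 n)).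
by exists 0 => //; split; [exact: jspace0|rewrite /= normr0].
Qed.

Lemma jeigenvalue_noninc m n : (m <= n)%N ->
  jeigenvalue mu S x n <= jeigenvalue mu S x m.
Proof.
move=> mn; apply: (opnorm_on_le SK); first exact: jspace0.
by move=> u nu i im; apply: nu; exact: leq_trans mn.
Qed.

(** In an infinite-dimensional space [n] functionals have a nonzero common zero, so
    the construction of the j-eigenvectors never stops. *)
Lemma jspace_nontrivial n : exists2 y, jspace mu x n y & S y != 0.
Proof.
have [[v vI _]|[m _ /infX //]] :=
  @indep_or_has_dim _ X [set: X] n.+1 I (fun _ _ _ _ _ => I).
have [c [c0 cJ]] := common_kernel_vector (f := fun j : 'I_n => J mu (x j))
  (fun j => J_linear mu (x j) smX) vI.
exists (\sum_i c i *: v i); last by apply: contra c0 => /eqP/Sinj ->.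
by move=> i iN; exact: (cJ (Ordinal iN)).
Qed.

Lemma jeigenvectorP n :
  [/\ jspace mu x n (x n), `|x n| = 1 & `|S (x n)| = jeigenvalue mu S x n].
Proof. exact/xP/jspace_nontrivial. Qed.

Lemma jeigenvector_neq0 n : x n != 0.
Proof. by rewrite -normr_eq0; have [_ -> _] := jeigenvectorP n; rewrite oner_neq0. Qed.

Lemma image_jeigenvector_neq0 n : S (x n) != 0.
Proof. by apply: contra (jeigenvector_neq0 n) => /eqP/Sinj ->. Qed.

Lemma J_jeigenvector i u : J mu (x i) u = Jtilde (x i) u.
Proof.
by rewrite /J (negPf (jeigenvector_neq0 i)); have [_ -> _] := jeigenvectorP i; rewrite mu1 mul1r.
Qed.

Lemma jeigen_triangular n (c : nat -> R) i : (i <= n)%N ->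
  jeigenvalue mu S x n * `|c i| <=
    2 ^+ n * `|S (\sum_(j < n.+1) c j *: x j)|.
Proof.
move=> iN.
have /choice[g gP] : forall k, exists g, norming_set (S (x k)) g.
  by move=> k; exact: norming_set_nonempty smX (image_jeigenvector_neq0 k).
have g0 k j : (k < j)%N -> g k (S (x j)) = 0.
  move=> kj; have [Dk xk1 Sxk] := jeigenvectorP k; have [Dj _ _] := jeigenvectorP j.
  apply: (norming_extremal (D := jspace mu x k) (f := Jtilde (x k))
    smX _ _ xk1 Sxk) => //.
  - exact: le_jeigenvalue.
  - move=> t; rewrite addrC; apply: jspaceP => // l lk; apply: Dj.
    exact: ltn_trans kj.
  - exact/JtildeP/jeigenvector_neq0.
  - by rewrite -J_jeigenvector; exact: Dj.
have := triangular_lower_bound c gP g0 iN.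
have [_ _ ->] := jeigenvectorP i.
move=> tri; rewrite (le_trans (ler_wpM2r _ (jeigenvalue_noninc iN))) //.
rewrite (le_trans tri) // ler_wpM2r // ler_weXn2l //.
by rewrite ler1n.
Qed.

(** A bound for [S] on the common zeros of fewer than [n + 1] functionals carries
    over to the j-eigenvalue of index [n], because some nonzero combination of
    [x_0, ..., x_n] is such a common zero. *)
Lemma jeigenvalue_upper n d (a : 'I_d -> X -> R) (b : R) : (d <= n)%N ->
  (forall j t u w, a j (t *: u + w) = t * a j u + a j w) ->
  0 <= b ->
  (forall u, (forall j, a j u = 0) -> `|S u| <= b * `|u|) ->
  jeigenvalue mu S x n <= n.+1%:R * 2 ^+ n * b.
Proof.
move=> dn aL b0 Sb.
have [c [i ci] ca] := exists_left_kernel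
  (fun (i : 'I_n.+1) j => a j (x i)) (dn : (d < n.+1)%N).
(* jeigen_triangular takes coefficients indexed by all natural numbers *)
pose c' k := c (inord k).
have c'E (j : 'I_n.+1) : c' j = c j by rewrite /c' inord_val.
pose z := \sum_(j < n.+1) c' j *: x j.
have z_le : `|z| <= \sum_j `|c j|.
  rewrite (le_trans (ler_norm_sum _ _ _)) //; apply: ler_sum => j _.
  by rewrite normrZ c'E; have [_ -> _] := jeigenvectorP j; rewrite mulr1.
have Sz : `|S z| <= b * \sum_j `|c j|.
  rewrite (le_trans (Sb z _)) ?ler_wpM2l // => j; rewrite -[RHS](ca j).
  rewrite /z scalar_map_sum; last exact: aL.
  by apply: eq_bigr => k _; rewrite c'E.
have csum : 0 < \sum_j `|c j|.
  rewrite (bigD1 i) //= ltr_pwDl ?normr_gt0 // sumr_ge0 //.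
rewrite -(ler_pM2r csum) mulr_sumr.
rewrite (@le_trans _ _ (\sum_(j < n.+1) 2 ^+ n * `|S z|)) //.
  apply: ler_sum => j _; rewrite -c'E; apply: jeigen_triangular.
  by rewrite -ltnS.
rewrite sumr_const card_ord -[leLHS]mulr_natl -!mulrA ler_pM2l ?ltr0n //.
by rewrite ler_pM2l ?exprn_gt0.
Qed.

End JEigen.

(** * Growth from below on a common kernel *)

Section Lower.
Context {R : realType} {X : normedModType R} (T : {linear X -> X}).
Local Notation VC := (complexification X).
Local Notation A := (complexify T).

(** A finite family of vectors is killed by a single product. *)
Lemma common_annihilator (Z : pred R[i]) n (v : 'I_n -> VC) :
  (forall i, spectral A Z (v i)) ->
  exists2 s, all Z s & forall i, shifts A s (v i) = 0.
Proof.
elim: n v => [|n IH] v vZ; first by exists [::] => // -[].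
have [s Zs sv] := IH (fun i => v (lift ord0 i)) (fun i => vZ _).
have [t Zt tv] := vZ ord0; exists (s ++ t); first by rewrite all_cat Zs.
move=> i; rewrite shifts_cat; case: (unliftP ord0 i) => [j|] ->.
  by rewrite shifts_comm sv linear0.
by rewrite tv linear0.
Qed.

(** The complexifications of the [f j] are [n] equations in [n + 1] complex unknowns. *)
Lemma spectral_vector_kernel n (f : 'I_n -> X -> R) (v : 'I_n.+1 -> VC) :
  (forall j a u w, f j (a *: u + w) = a * f j u + f j w) ->
  lin_indep v ->
  exists c : 'I_n.+1 -> R[i], \sum_i c i *: v i != 0 /\
    forall j, f j (\sum_i c i *: v i).1 = 0 /\ f j (\sum_i c i *: v i).2 = 0.
Proof.
move=> fL vI; (* f j extended to the complexification *)
pose F j (w : VC) : R[i] := (f j w.1 +i* f j w.2)%C.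
have fD j u w : f j (u + w) = f j u + f j w.
  by have := fL j 1 u w; rewrite scale1r mul1r.
have f0 j : f j 0 = 0 by exact: scalar_map0.
have fZ j a u : f j (a *: u) = a * f j u.
  by have := fL j a u 0; rewrite !addr0 f0 addr0.
have fN j u : f j (- u) = - f j u by rewrite -scaleN1r fZ mulN1r.
have FL j a u w : F j (a *: u + w) = a * F j u + F j w.
  case: a u w => [a b] [u u'] [w w']; rewrite /F /=.
  by rewrite !fD fN !fZ; congr (_ +i* _)%C.
have [c [c0 cF]] := common_kernel_vector FL vI.
exists c; split => // j; have := cF j; rewrite /F => /eqP.
by rewrite eq_complex /= => /andP[/eqP -> /eqP ->].
Qed.

(** The constant [C] serves all [k] and all [f]: the [n + 1] generalized eigenvectors,
    and the product that kills them, are chosen beforehand. *)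
Lemma kernel_lower_bound n (lam : nat -> R[i]) K rho :
  eigenvalue_sequence T lam -> 0 <= K -> (forall u, `|T u| <= K * `|u|) ->
  0 < rho < normc (lam n) ->
  exists2 C, 0 < C & forall k b (f : 'I_n -> X -> R),
    (forall j a u w, f j (a *: u + w) = a * f j u + f j w) ->
    (forall u, (forall j, f j u = 0) -> `|iter k T u| <= b * `|u|) ->
    rho ^+ k <= C * b.
Proof.
move=> lamP K0 TK rhol; have ln0 : lam n != 0.
  by apply: contraTneq rhol => ->; rewrite normc0; case: ltP => // /ltW/le_gtF ->.
have [v vI vZ] := spectral_indep_ge lamP ln0.
have [s Zs sv] := common_annihilator vZ.
have [C C0 CP] := spectral_lower_growth K0 TK rhol Zs.
exists C => // k b f fL fb.
have [c [w0 fw]] := spectral_vector_kernel fL vI.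
move: w0 fw; set w := \sum_i _ => w0 fw.
have sw : shifts A s w = 0.
  by rewrite linear_sum big1 // => i _; rewrite linearZ /= sv scaler0.
have w_gt0 : 0 < cnorm w.
  by rewrite lt_def cnorm_ge0 andbT; apply: contra w0 => /eqP/cnorm_eq0 ->.
rewrite -(ler_pM2r w_gt0) (le_trans (CP k w sw)) // -mulrA ler_pM2l //.
rewrite iter_complexify /cnorm /= mulrDr lerD //; apply: fb => j.
  by have [] := fw j.
by have [] := fw j.
Qed.

End Lower.

(** * Deflation by a finite-rank projection *)

Section SpectralProjection.
Context {R : realType} {X : normedModType R}.

Definition bounded_functional (f : X -> R) :=
  (forall a u w, f (a *: u + w) = a * f u + f w) /\
  exists2 K, 0 <= K & forall u, `|f u| <= K * `|u|.

Lemma bounded_functional_comb f g a : bounded_functional f ->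
  bounded_functional g -> bounded_functional (fun u => a * f u + g u).
Proof.
move=> [fL [K K0 fK]] [gL [M M0 gM]]; split.
  by move=> b u w; rewrite fL gL; ring.
exists (`|a| * K + M) => [|u]; first by rewrite addr_ge0 ?mulr_ge0.
rewrite (le_trans (ler_normD _ _)) // mulrDl lerD // normrM -mulrA.
by rewrite ler_wpM2l.
Qed.

Lemma bounded_functional_sum n (c : 'I_n -> R) (f : 'I_n -> X -> R) :
  (forall i, bounded_functional (f i)) ->
  bounded_functional (fun u => \sum_i c i * f i u).
Proof.
elim: n c f => [|n IH] c f fB.
  split=> [a u w|]; first by rewrite !big_ord0 mulr0 addr0.
  by exists 0 => // u; rewrite big_ord0 normr0 mul0r.
under eq_fun => u do rewrite big_ord_recl.
apply: bounded_functional_comb => //.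
by apply: (IH (fun i => c (lift ord0 i)) (fun i => f (lift ord0 i))) => i; exact: fB.
Qed.

Lemma norming_functional (z : X) : uniformly_smooth X -> z != 0 ->
  exists2 f, bounded_functional f & f z = `|z|.
Proof.
move=> smX z0; have [f fP] := norming_set_nonempty smX z0.
have [[fL _] _ fz] := fP; exists f => //; split; first exact: fL.
by exists 1 => // u; rewrite mul1r; exact: norming_bound fP u.
Qed.

Definition biorthogonal n (e : 'I_n -> X) (f : 'I_n -> X -> R) :=
  (forall i, bounded_functional (f i)) /\ forall i j, f i (e j) = (i == j)%:R.

Lemma biorthogonal_free n (e : 'I_n -> X) f : biorthogonal e f -> lin_indep e.
Proof.
move=> [fB fe] c ce i; have [fL _] := fB i.
rewrite -(scalar_map0 fL) -ce scalar_map_sum //.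
rewrite (bigD1 i) //= fe eqxx mulr1 big1 ?addr0 // => j ji.
by rewrite fe eq_sym (negPf ji) mulr0.
Qed.

(** Gram-Schmidt process: a vector of [E] outside the span is made orthogonal to the
    functionals found so far, and a functional norming the result is made to vanish
    on the vectors found so far. *)
Lemma biorthogonal_dichotomy (E : set X) n : uniformly_smooth X ->
  E 0 -> (forall a u w, E u -> E w -> E (a *: u + w)) ->
  (exists e f, @biorthogonal n e f /\ forall i, E (e i)) \/
  (exists2 m, (m < n)%N & exists e f, [/\ @biorthogonal m e f,
     forall i, E (e i) & forall u, E u -> \sum_i f i u *: e i = u]).
Proof.
move=> smX E0 EL; elim: n => [|n [[e [f [[fB fe] Ee]]]|[m mn mP]]]; last 1 first.
- by right; exists m => //; exact: ltnW.
- by left; exists (fun=> 0), (fun _ _ => 0); split=> [|[]//]; split=> -[].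
have [spanE|/existsNP[w /not_implyP[Ew /eqP we]]] :=
  pselect (forall u, E u -> \sum_i f i u *: e i = u).
  by right; exists n => //; exists e, f.
left; pose w' := w - \sum_i f i w *: e i.
have w'0 : w' != 0 by rewrite subr_eq0 eq_sym.
have Ew' : E w'.
  rewrite /w' addrC -scaleN1r; apply: (EL) => //.
  exact: linear_set_sum.
have fw' i : f i w' = 0.
  have [fL _] := fB i.
  rewrite /w' addrC -scaleN1r fL scalar_map_sum //.
  rewrite (bigD1 i) //= fe eqxx mulr1 big1 ?addr0 ?mulN1r ?addNr // => j ji.
  by rewrite fe eq_sym (negPf ji) mulr0.
have [g gB gw'] := norming_functional smX w'0.
(* g normalized at w', then corrected to vanish on the vectors e i *)
pose h u := `|w'|^-1 * g u + \sum_i (- (`|w'|^-1 * g (e i))) * f i u.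
have hB : bounded_functional h.
  by apply: bounded_functional_comb => //; exact: bounded_functional_sum.
have hw' : h w' = 1.
  rewrite /h gw' mulVf ?normr_eq0 // big1 ?addr0 // => i _.
  by rewrite fw' mulr0.
have he j : h (e j) = 0.
  rewrite /h (bigD1 j) //= fe eqxx mulr1 big1 ?addr0 ?subrr // => i ij.
  by rewrite fe (negPf ij) mulr0.
exists (fun i => if unlift ord_max i is Some j then e j else w').
exists (fun i => if unlift ord_max i is Some j then f j else h).
split; last by move=> i; case: (unlift ord_max i).
split; first by move=> i; case: (unlift ord_max i).
move=> i j; case: (unliftP ord_max i) => [i' ->|->];
  case: (unliftP ord_max j) => [j' ->|->].
- by rewrite fe (inj_eq lift_inj).
- by rewrite fw' eq_sym (negPf (neq_lift _ _)).
- by rewrite he (negPf (neq_lift _ _)).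
- by rewrite hw' eqxx.
Qed.

End SpectralProjection.

Section Upper.
Context {R : realType} {X : normedModType R} (T : {linear X -> X}).
Local Notation VC := (complexification X).
Local Notation A := (complexify T).

Definition conj_vec (w : VC) : VC := (w.1, - w.2).

Lemma shift_conj_vec z w : shift A z^*%C (conj_vec w) = conj_vec (shift A z w).
Proof.
case: z w => [a b] [u v]; rewrite /shift /conj_vec /complexify /=.
congr pair => /=; first by rewrite scaleNr scalerN opprK.
by rewrite linearN scalerN scaleNr !opprD opprK.
Qed.

Lemma spectral_conj_vec (Z : pred R[i]) w : (forall z, Z z -> Z z^*%C) ->
  spectral A Z w -> spectral A Z (conj_vec w).
Proof.
move=> ZC [s Zs sw]; exists (map (@conjc R) s).
  by elim: s Zs {sw} => //= z s IH /andP[/ZC -> /IH].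
have -> : shifts A (map (@conjc R) s) (conj_vec w) = conj_vec (shifts A s w).
  by elim: s {Zs sw} => //= z s ->; rewrite shift_conj_vec.
by rewrite sw /conj_vec /= oppr0.
Qed.

(** A set of scalars stable under conjugation gives a subspace stable under
    conjugation, hence the complexification of its real part. *)
Lemma spectral_real (Z : pred R[i]) (u v : X) : (forall z, Z z -> Z z^*%C) ->
  spectral A Z (u, v) <-> spectral A Z (u, 0) /\ spectral A Z (v, 0).
Proof.
move=> ZC.
have uvE (a b : X) : ((a, b) : VC) = 'i%C *: ((b, 0) : VC) + (a, 0).
  by congr pair; rewrite /= ?scale0r ?scaler0 ?subr0 ?scale1r ?add0r ?addr0.
split=> [Zuv|[Zu Zv]]; last by rewrite uvE; exact: spectralP.
have Zu : spectral A Z (u, 0).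
  have -> : ((u, 0) : VC) = (2^-1)%:C%C *: (((u, v) : VC) + conj_vec (u, v)).
    rewrite /conj_vec; congr pair => /=; rewrite scale0r.
      by rewrite subr0 -mulr2n -[u *+ 2]scaler_nat scalerA mulVf ?scale1r // pnatr_eq0.
    by rewrite subrr scaler0 addr0.
  by apply/spectralZ/spectralD => //; exact: spectral_conj_vec.
split => //.
have -> : ((v, 0) : VC) = - 'i%C *: (((u, v) : VC) - ((u, 0) : VC)).
  congr pair => /=; rewrite oppr0 scale0r ?subrr ?scaler0 ?addr0 //.
  by rewrite sub0r subr0 scaleN1r opprK.
by apply/spectralZ/spectralB.
Qed.


Section Projection.
Context (d : nat) (e : 'I_d -> X) (f : 'I_d -> X -> R) (ef : biorthogonal e f).

Definition biorth_proj (u : X) : X := \sum_i f i u *: e i.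

Fact biorth_proj_is_linear : linear biorth_proj.
Proof.
move=> a u w; rewrite /biorth_proj scaler_sumr -big_split; apply: eq_bigr => i _ /=.
by have [fL _] := ef.1 i; rewrite fL scalerDl scalerA.
Qed.

Definition projection : {linear X -> X} :=
  HB.pack biorth_proj (GRing.isLinear.Build R X X *:%R biorth_proj biorth_proj_is_linear).

Lemma biorth_proj_bounded : exists2 M, 0 <= M & forall u, `|biorth_proj u| <= M * `|u|.
Proof.
have /choice[M MP] : forall i, exists M, 0 <= M /\ forall u, `|f i u| <= M * `|u|.
  by move=> i; have [_ [M M0 fM]] := ef.1 i; exists M.
exists (\sum_i M i * `|e i|) => [|u].
  by rewrite sumr_ge0 // => i _; rewrite mulr_ge0 //; have [] := MP i.
rewrite (le_trans (ler_norm_sum _ _ _)) // mulr_suml; apply: ler_sum => i _.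
by rewrite normrZ mulrAC ler_wpM2r //; have [_] := MP i; apply.
Qed.

Fact deflation_is_linear : linear (fun u => T u - projection (T u)).
Proof. by move=> a u w; rewrite !linearP /= scalerDr addrACA. Qed.

(** On the range of the projection, where [T] has its large eigenvalues, this
    operator vanishes provided that [T] preserves the range. *)
Definition deflation : {linear X -> X} :=
  HB.pack (fun u => T u - projection (T u))
    (GRing.isLinear.Build R X X *:%R _ deflation_is_linear).

Lemma deflation_compact : compact_map T -> compact_map deflation.
Proof.
move=> cT; have [M M0 projM] := biorth_proj_bounded.
have proj_cont : continuous projection.
  apply/linear_bounded_continuous/linear_boundedP.
  exists M; split; first exact: num_real.
  by move=> N /ltW MN u; rewrite (le_trans (projM u)) // ler_wpM2r.
pose B := closure (T @` [set x | `|x| <= 1]).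
have cB : compact ((fun v => v - projection v) @` B).
  apply: continuous_compact => //; apply: continuous_subspaceT => v.
  by apply: cvgB => //; exact: proj_cont.
have BH : closed ((fun v => v - projection v) @` B).
  by apply: compact_closed => //; exact: norm_hausdorff.
apply: (subclosed_compact (@closed_closure _ _) cB).
rewrite [X in _ `<=` X]((closure_id _).1 BH); apply: closure_subset.
move=> _ [u u1 <-]; exists (T u) => //; apply: subset_closure.
by exists u.
Qed.

End Projection.

End Upper.

Section UpperBound.
Context {R : realType} {X : normedModType R} (T : {linear X -> X}).
Local Notation VC := (complexification X).
Local Notation A := (complexify T).

Lemma complex_indep_of_real m (e : 'I_m -> X) :
  lin_indep e -> lin_indep (fun i => ((e i, 0) : VC)).
Proof.
move=> eI c ce.
have re : \sum_i complex.Re (c i) *: e i = 0.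
  rewrite -[RHS]/((0 : VC).1) -ce.
  elim/big_rec2: _ => [|i w y _ ->] //=.
  by rewrite scaler0 subr0.
have im : \sum_i complex.Im (c i) *: e i = 0.
  rewrite -[RHS]/((0 : VC).2) -ce.
  elim/big_rec2: _ => [|i w y _ ->] //=.
  by rewrite scaler0 add0r.
move=> i; have := eI _ re i; have := eI _ im i.
by case: (c i) => a b /= -> ->.
Qed.

(** The [f j] are the coordinates of a projection [P] onto the real part [E] of the
    sum of the generalized eigenspaces for [|z| > |lam n|]. An eigenvector of
    [(1 - P) T] for such a [z] lies in the kernel of [P], and [T - z] maps it into
    the complexification of [E]; hence it belongs to the latter, so it is 0. As [T]
    preserves [E], [((1 - P) T)^k = (1 - P) T^k] for [k > 0]. *)
Lemma kernel_upper_bound n (lam : nat -> R[i]) s :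
  uniformly_smooth X -> compact_map T -> eigenvalue_sequence T lam ->
  normc (lam n) < s ->
  exists d, exists f : 'I_d -> X -> R, exists C, [/\ (d <= n)%N,
    forall j a u w, f j (a *: u + w) = a * f j u + f j w, 0 <= C &
    forall k u, (forall j, f j (iter k.+1 T u) = 0) ->
      `|iter k.+1 T u| <= C * s ^+ k.+1 * `|u|].
Proof.
move=> smX cT lamP lns; have s0 : 0 < s := le_lt_trans (normc_ge0 _) lns.
pose Z := [pred z | normc (lam n) < normc z].
have ZC z : Z z -> Z z^*%C.
  by rewrite /Z /=; case: z => a b /=; rewrite sqrrN.
pose E : set X := [set u | spectral A Z (u, 0)].
have E0 : E 0 by exact: spectral0.
have EL a u w : E u -> E w -> E (a *: u + w).
  move=> Eu Ew; rewrite /E /=.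
  have -> : ((a *: u + w, 0) : VC) = a%:C%C *: ((u, 0) : VC) + (w, 0).
    by congr pair; rewrite /= ?scale0r ?scaler0 ?subr0 ?addr0.
  exact: spectralP.
have ET u : E u -> E (T u).
  move=> /spectral_T; rewrite /E /=.
  by rewrite /complexify /= linear0.
have [m mn [b bP]] := spectral_spanned_gt lamP n.
have [[e [f [ef Ee]]]|[d dm [e [f [ef Ee fE]]]]] :=
    biorthogonal_dichotomy m.+1 smX E0 EL.
  have := span_bounds_indep (fun i => bP _ (Ee i))
    (complex_indep_of_real (biorthogonal_free ef)).
  by rewrite ltnn.
pose P := projection ef; pose S := deflation T ef.
have EP u : E (P u) by exact: linear_set_sum.
have PE u : E u -> P u = u by exact: fE.
have SE u : S u = T u - P (T u) by [].
have PS u : P (S u) = 0 by rewrite SE linearB [P (P _)]PE ?subrr.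
have [C C0 SC] : power_bound S s.
  apply: compact_power_bound => //; first exact: deflation_compact.
  move=> z w sz Sw.
  have z0 : z != 0.
    by apply: contraTneq sz => ->; rewrite normc0 -ltNge.
  have Pw : complexify P w = 0.
    have : complexify P (complexify S w) = 0 by congr pair; exact: PS.
    rewrite Sw linearZ => /eqP; rewrite scaler_eq0 (negPf z0).
    by move=> /eqP.
  have shw : shift A z w = complexify P (A w).
    apply/eqP; rewrite subr_eq addrC -subr_eq -Sw; apply/eqP.
    by [].
  have Zw : spectral A Z w.
    apply: (@spectral_shift_inv _ _ _ _ z); first exact: lt_le_trans sz.
    by rewrite shw; apply/(spectral_real T _ _ ZC); split; exact: EP.
  have [Ew1 Ew2] : E w.1 /\ E w.2 by apply/(spectral_real T _ _ ZC); case: (w) Zw.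
  rewrite -Pw; case: w Ew1 Ew2 {Sw Pw shw Zw} => u v /= Eu Ev.
  by congr pair; exact/esym/PE.
exists d, f, C; split=> //; first exact: leq_trans mn.
  by move=> j; have [] := ef.1 j.
have iter_S k u : iter k.+1 S u = iter k.+1 T u - P (iter k.+1 T u).
  elim: k => [|k IH]; first by [].
  have TPE y : P (T (P y)) = T (P y) by apply/PE/ET/EP.
  by rewrite iterS IH SE [T (_ - _)]linearB [P (_ - _)]linearB TPE opprB addrA subrK.
move=> k u fu.
have Pk : P (iter k.+1 T u) = 0.
  by rewrite -[P _]/(biorth_proj e f _) /biorth_proj big1 // => j _; rewrite fu scale0r.
have Su : `|iter k.+1 S u| <= cnorm (iter k.+1 (complexify S) (u, 0)).
  by rewrite iter_complexify /cnorm lerDl.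
have nu : cnorm ((u, 0) : VC) = `|u| by rewrite /cnorm normr0 addr0.
by move: Su; rewrite iter_S Pk subr0 -nu => /le_trans; apply; exact: SC.
Qed.

End UpperBound.

(** * From exponential bounds to the limit *)

Section RootLimit.
Context {R : realType}.

Lemma expr_dominates (q C : R) : 1 < q -> \forall k \near \oo, C <= q ^+ k.
Proof.
move=> q1; have q0 : 0 < q by apply: lt_trans q1.
have lim : (fun k => q^-1 ^+ k) @ \oo --> (0 : R).
  by apply: cvg_expr; rewrite gtr0_norm ?invr_gt0 // invf_lt1.
move: lim => /cvgrPdist_le /(_ ((`|C| + 1)^-1)).
have C1 : 0 < `|C| + 1 by rewrite ltr_wpDl.
rewrite invr_gt0 => /(_ C1); apply: filterS => k.
rewrite sub0r normrN exprVn ger0_norm ?invr_ge0 ?exprn_ge0 ?(ltW q0) //.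
rewrite lef_pV2 ?posrE ?exprn_gt0 // => /(le_trans _); apply.
by rewrite (le_trans (ler_norm _)) // lerDl.
Qed.

(** Enlarging the base absorbs the constants: [C * s ^ k <= (r + e) ^ k] for large
    [k] when [s < r + e], and similarly from below. *)
Lemma root_limit (a : nat -> R) (r : R) : 0 <= r -> (forall k, 0 <= a k) ->
  (forall s, r < s -> exists C, forall k, (0 < k)%N -> a k <= C * s ^+ k) ->
  (forall p, 0 < p < r ->
    exists2 C, 0 < C & forall k, (0 < k)%N -> p ^+ k <= C * a k) ->
  a k `^ k%:R^-1 @[k --> \oo] --> r.
Proof.
move=> r0 a0 up low; apply/cvgrPdist_le => e e0.
have root (b : R) k : 0 <= b -> (0 < k)%N -> (b ^+ k) `^ k%:R^-1 = b.
  move=> b0 k0; rewrite -powR_mulrn // -powRrM mulfV ?powRr1 //.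
  by rewrite pnatr_eq0 -lt0n.
have monot (b c : R) k : 0 <= b <= c -> b `^ k%:R^-1 <= c `^ k%:R^-1.
  move=> /andP[b0 bc]; rewrite ge0_ler_powR ?invr_ge0 ?ler0n ?nnegrE //.
  exact: le_trans bc.
have rs : r < r + e / 2 by rewrite ltrDl divr_gt0.
have [C CP] := up _ rs.
have re2 : 0 < r + e / 2 by rewrite ltr_wpDl // divr_gt0.
have re : 0 < r + e by rewrite ltr_wpDl.
have upper : \forall k \near \oo, a k `^ k%:R^-1 <= r + e.
  have q1 : 1 < (r + e) / (r + e / 2).
    by rewrite ltr_pdivlMr // mul1r ltrD2l ltr_pdivrMr // ltr_pMr // ltr1n.
  near=> k; have k0 : (0 < k)%N by near: k; exact: nbhs_infty_gt.
  rewrite -[leRHS](root _ k) ?(ltW re) //; apply: monot; rewrite a0 /=.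
  rewrite (le_trans (CP k k0)) // -ler_pdivlMr ?exprn_gt0 // -expr_div_n.
  by near: k; exact: expr_dominates.
have lower : \forall k \near \oo, r - e <= a k `^ k%:R^-1.
  have [ren|rep] := leP (r - e) 0.
    by apply: nearW => k; rewrite (le_trans ren) // powR_ge0.
  have rep2 : 0 < r - e / 2 by lra.
  have [|D D0 DP] := low (r - e / 2); first by rewrite rep2 /=; lra.
  have q1 : 1 < (r - e / 2) / (r - e).
    by rewrite ltr_pdivlMr // mul1r; lra.
  near=> k; have k0 : (0 < k)%N by near: k; exact: nbhs_infty_gt.
  rewrite -[leLHS](root _ k) ?(ltW rep) //; apply: monot.
  rewrite exprn_ge0 ?(ltW rep) //= -(ler_pM2l D0) (le_trans _ (DP k k0)) //.
  rewrite -ler_pdivlMr ?exprn_gt0 // -expr_div_n.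
  by near: k; exact: expr_dominates.
near=> k; rewrite ler_distlC; apply/andP; split.
  by near: k.
by near: k.
Unshelve. all: by end_near.
Qed.

End RootLimit.

Theorem theorem3p5 (R : realType) (X : completeNormedModType R)
    (mu : R -> R) (T : {linear X -> X})
    (lamhat : nat -> R[i]) (x : nat -> nat -> X) :
  reflexive_space X -> infinite_dimensional X ->
  uniformly_convex X -> uniformly_smooth X ->
  is_gauge mu -> mu 1 = 1 ->
  compact_map T ->
  (forall u : X, T u = 0 -> u = 0) ->
  dense (range T) ->
  eigenvalue_sequence T lamhat ->
  (forall k : nat, (0 < k)%N -> jeigenvectors mu (iter k T) (x k)) ->
  forall n : nat,
    (jeigenvalue mu (iter k T) (x k) n) `^ (k%:R^-1) @[k --> \oo]
      --> complex.Re `|lamhat n|.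
Proof.
move=> _ infX _ smX _ mu1 cT Tinj _ lamP xP n.
have [K K0 TK] := compact_map_bounded cT.
have iterL k : linear (iter k T : X -> X).
  by elim: k => // k IH a u w; rewrite !iterS IH linearP.
pose Tk k : {linear X -> X} :=
  HB.pack (iter k T : X -> X) (GRing.isLinear.Build _ _ _ _ _ (iterL k)).
have TkK k u : `|Tk k u| <= K ^+ k * `|u|.
  elim: k => [|k IH]; first by rewrite mul1r.
  rewrite [Tk _ u]/= (le_trans (TK _)) // exprS -mulrA ler_wpM2l //.
  exact: ltW.
have Tkinj k u : Tk k u = 0 -> u = 0.
  by elim: k => //= k IH /Tinj; exact: IH.
rewrite Re_norm; apply: root_limit.
- exact: normc_ge0.
- by move=> k; exact: (jeigenvalue_ge0 mu (x k) smX (TkK k)).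
- move=> s ls; have s0 : 0 <= s := le_trans (normc_ge0 _) (ltW ls).
  have [d [f [C [dn fL C0 fC]]]] := kernel_upper_bound smX cT lamP ls.
  exists (n.+1%:R * 2 ^+ n * C) => -[//|k] _; rewrite -(mulrA _ C).
  pose a j u := f j (Tk k.+1 u).
  have aL j t u w : a j (t *: u + w) = t * a j u + a j w.
    by rewrite /a linearP fL.
  have up := @jeigenvalue_upper _ _ mu (Tk k.+1) _ (x k.+1) smX infX mu1 (TkK k.+1)
    (@Tkinj k.+1) (xP k.+1 isT) n d a (C * s ^+ k.+1) dn aL.
  apply: up => [|u fu].
    by rewrite mulr_ge0 ?exprn_ge0.
  exact: fC.
- move=> p /(kernel_lower_bound lamP (ltW K0) TK)[C C0 CP]; exists C => // k k0.
  apply: (CP k _ (fun j : 'I_n => J mu (x k j))) => [j|u Ju].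
    exact: J_linear.
  apply: (le_jeigenvalue smX (TkK k)) => i iN; exact: (Ju (Ordinal iN)).
Qed.
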